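(* Let $\mathcal N$ be a finite, locally irreducible and strongly connected agent network with total alphabet $A$, total kernel $K$ and production matrix $P$. Let $(z_a)_{a\in A}$ be indeterminates and let $I(z)$ be the diagonal $A\times A$ matrix with $I(z)(a,a)=\frac1{1-z_a}$. For $\mathbf n\in\mathbb N^A$ let $\mathrm{Rec}(\mathcal N,\mathbf n)$ be the set of recurrent configurations $\mathbf x.\mathbf q$ of $\mathcal N$ with $\mathbf x=\mathbf n$. Then, in the ring of formal power series in $(z_a)_{a\in A}$, $$|\mathbb Z^A/K|\,\det\bigl(I(z)-P\bigr)=\sum_{\mathbf n\in\mathbb N^A}|\mathrm{Rec}(\mathcal N,\mathbf n)|\,z^{\mathbf n},\qquad z^{\mathbf n}=\prod_{a\in A}z_a^{\mathbf n(a)}.$$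
   Context: Abelian networks. $\mathbb N=\{0,1,2,\dots\}$. Let $G=(V,E)$ be a finite directed graph (self-loops and multiple edges allowed). An abelian network $\mathcal N$ on $G$ assigns to each $v\in V$ a nonempty input alphabet $A_v$ and a nonempty state space $Q_v$ (the $A_v$ pairwise disjoint), maps $T_a:Q_v\to Q_v$ for $a\in A_v$, and, for each edge $e$ from $v$ to $u$, a message-passing function $T_e:Q_v\times A_v\to A_u^*$ (free monoid of words), such that for all $v$, $a,b\in A_v$, $q\in Q_v$: $T_aT_b=T_bT_a$, and for every edge $e$ out of $v$ the words $T_e(q,a)T_e(T_a(q),b)$ and $T_e(q,b)T_e(T_b(q),a)$ agree up to permuting letters. Put $A=\bigsqcup_v A_v$, $Q=\prod_v Q_v$; $\mathcal N$ is finite if $A$ and $Q$ are finite. For a word $w\in A^*$, $|w|\in\mathbb N^A$ counts the occurrences of each letter. For $a\in A_v$, $\mathbf q\in Q$: $t_a\mathbf q$ is $\mathbf q$ with $\mathbf q(v)$ replaced by $T_a(\mathbf q(v))$, and $\mathbf M_a(\mathbf q)=\sum_{e\text{ out of }v}|T_e(\mathbf q(v),a)|\in\mathbb N^A$. A configuration is a pair $\mathbf x.\mathbf q$ with $\mathbf x\in\mathbb Z^A$, $\mathbf q\in Q$; $\pi_a(\mathbf x.\mathbf q)=(\mathbf x+\mathbf M_a(\mathbf q)-|a|).t_a\mathbf q$. For $w=a_1\cdots a_\ell$: $t_w=t_{a_\ell}\cdots t_{a_1}$, $\mathbf M_w(\mathbf q)=\sum_i\mathbf M_{a_i}(t_{a_1\cdots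 a_{i-1}}\mathbf q)$, $\pi_w=\pi_{a_\ell}\cdots\pi_{a_1}$; these depend only on $|w|$, so $t_{\mathbf n},\mathbf M_{\mathbf n},\pi_{\mathbf n}$ are defined for $\mathbf n\in\mathbb N^A$. The word $w$ is legal for $\mathbf x.\mathbf q$ if, with $\mathbf x_i.\mathbf q_i=\pi_{a_1\cdots a_i}(\mathbf x.\mathbf q)$, $\mathbf x_{i-1}(a_i)\ge1$ for all $1\le i\le\ell$. Write $\mathbf x.\mathbf q\to\mathbf x'.\mathbf q'$ if $\pi_w(\mathbf x.\mathbf q)=\mathbf x'.\mathbf q'$ for some (possibly empty) word $w$ legal for $\mathbf x.\mathbf q$. Local recurrence, kernel, production matrix. $\mathcal N$ is locally irreducible if for all $\mathbf q,\mathbf q'\in Q$ there are words $w,w'$ with $t_w\mathbf q=t_{w'}\mathbf q'$. For $\mathcal N$ finite, let $e$ be the product of all idempotents of the finite commutative monoid generated by the $t_a$ in $\mathrm{End}(Q)$; $\mathrm{Loc}(\mathcal N)=eQ$ is the set of locally recurrent states. The total kernel is $K=\{\mathbf z\in\mathbb Z^A: t_{\mathbf z^+}\mathbf q=t_{\mathbf z^-}\mathbf q\ \forall\mathbf q\in\mathrm{Loc}(\mathcal N)\}$, with $\mathbf z^{\pm}\in\mathbb N^A$ the positive/negative parts of $\mathbf z$; it is a finite-index subgroup of $\mathbb Z^A$. For $\mathcal N$ finite and locally irreducible, the production matrix $P$ is the unique rational $A\times A$ matrix with $P\mathbf k=\mathbf M_{\mathbf k}(\mathbf q)$ for all $\mathbf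 k\in K\cap\mathbb N^A$ and $\mathbf q\in\mathrm{Loc}(\mathcal N)$. $\mathcal N$ is strongly connected if the digraph on $A$ with an edge $(a,b)$ whenever $P_{ba}>0$ is strongly connected. Agent networks and recurrence. An agent network is an abelian network with $\sum_{b\in A}\mathbf M_a(\mathbf q)(b)=1$ for all $a\in A$, $\mathbf q\in Q$; its production matrix has spectral radius $1$. Two configurations are legally related if there is a configuration $\mathbf x_3.\mathbf q_3$ with $\mathbf x_1.\mathbf q_1\to\mathbf x_3.\mathbf q_3$ and $\mathbf x_2.\mathbf q_2\to\mathbf x_3.\mathbf q_3$. A configuration $\mathbf x.\mathbf q$ is recurrent if there is a nonempty legal execution for $\mathbf x.\mathbf q$, and every configuration $\mathbf x'.\mathbf q'$ legally related to $\mathbf x.\mathbf q$ satisfies $\mathbf x'.\mathbf q'\to\mathbf x.\mathbf q$. *)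

(* Defs.v *)
From HB Require Import structures.
From mathcomp Require Import all_boot all_order all_algebra finmap.
From mathcomp Require Import boolp classical_sets cardinality.

Set Implicit Arguments.
Unset Strict Implicit.
Unset Printing Implicit Defensive.

Import Order.TTheory GRing.Theory Num.Theory.

Local Open Scope ring_scope.

(* A series is given by its coefficient function on exponents [A -> nat]. *)
Record fps (A : finType) (R : comNzRingType) :=
  Fps { fpscoef : {ffun A -> nat} -> R }.

HB.instance Definition _ (A : finType) (R : comNzRingType) :=
  gen_eqMixin (fps A R).
HB.instance Definition _ (A : finType) (R : comNzRingType) :=
  gen_choiceMixin (fps A R).

Section Fps.
Variables (A : finType) (R : comNzRingType).
Implicit Types (n i j : {ffun A -> nat}) (f g h : fps A R).

Lemma fpsP f g : (forall n, fpscoef f n = fpscoef g n) -> f = g.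
Proof. by case: f g => [f] [g] /= fg; congr Fps; apply/funext. Qed.

(* The exponents that are pointwise at most [n]. *)
Definition below n : seq {ffun A -> nat} :=
  [seq [ffun a => i a : nat] | i : {dffun forall a : A, 'I_(n a).+1}].

Definition expB n i : {ffun A -> nat} := [ffun a => (n a - i a)%N].

Lemma mem_below n i : (i \in below n) = [forall a, (i a <= n a)%N].
Proof.
apply/fintype.imageP/forallP => [[j _ ->] a|le_in]; first by rewrite ffunE -ltnS ltn_ord.
exists (finfun (fun a => inord (i a) : 'I_(n a).+1)) => //.
by apply/ffunP => a; rewrite !ffunE inordK // ltnS.
Qed.

Lemma below_uniq n : uniq (below n).
Proof.
rewrite map_inj_uniq ?enum_uniq // => i j /ffunP ij.
by apply/ffunP => a; apply/val_inj; have:= ij a; rewrite !ffunE.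
Qed.

Lemma belowP n i : reflect (forall a, (i a <= n a)%N) (i \in below n).
Proof. by rewrite mem_below; apply: forallP. Qed.

Lemma expBK n i : i \in below n -> expB n (expB n i) = i.
Proof. by move/belowP => le_in; apply/ffunP => a; rewrite !ffunE subKn. Qed.

Lemma expB_below n i : expB n i \in below n.
Proof. by apply/belowP => a; rewrite ffunE leq_subr. Qed.

Lemma big_below_rev n (F : {ffun A -> nat} -> R) :
  \sum_(i <- below n) F i = \sum_(i <- below n) F (expB n i).
Proof.
rewrite -(big_map (expB n) xpredT F); apply: perm_big.
have inj : {in below n &, injective (expB n)}.
  by move=> i j ni nj eq_ij; rewrite -(expBK ni) eq_ij expBK.
apply: uniq_perm; first exact: below_uniq.
  by rewrite map_inj_in_uniq //; apply: below_uniq.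
move=> i.
apply/idP/mapP => [ni|[j nj ->]]; last exact: expB_below.
by exists (expB n i); rewrite ?expBK ?expB_below.
Qed.

Lemma big_below_sub n m (F : {ffun A -> nat} -> R) : m \in below n ->
  \sum_(i <- below m) F i = \sum_(i <- below n | i \in below m) F i.
Proof.
move/belowP => mn; rewrite -[RHS]big_filter; apply: perm_big.
apply: uniq_perm; rewrite ?filter_uniq ?below_uniq // => i.
rewrite mem_filter; apply/idP/andP => [mi|[]//]; split=> //.
by apply/belowP => a; apply: leq_trans (belowP _ _ mi a) (mn a).
Qed.

Lemma big_below_shift n i (F : {ffun A -> nat} -> R) : i \in below n ->
  \sum_(l <- below n | i \in below l) F (expB l i)
  = \sum_(j <- below (expB n i)) F j.
Proof.
move/belowP => le_in; rewrite -big_filter -(big_map (expB^~ i) xpredT F).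
apply: perm_big; apply: uniq_perm; rewrite ?below_uniq //.
  rewrite map_inj_in_uniq ?filter_uniq ?below_uniq // => k l.
  rewrite !mem_filter => /andP[/belowP ik _] /andP[/belowP il _] /ffunP kl.
  apply/ffunP => a; have := kl a; rewrite !ffunE => /(congr1 (addn^~ (i a))).
  by rewrite /= !subnK.
move=> j; apply/mapP/belowP => [[l]|jn].
  rewrite mem_filter => /andP[/belowP il /belowP ln] -> a.
  by rewrite !ffunE leq_sub2r.
exists [ffun a => (j a + i a)%N].
  rewrite mem_filter; apply/andP; split; apply/belowP => a; rewrite !ffunE.
    exact: leq_addl.
  by have := jn a; rewrite ffunE leq_subRL // addnC.
by apply/ffunP => a; rewrite !ffunE addnK.
Qed.

Definition fps0 : fps A R := Fps (fun=> 0).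
Definition fps_opp f : fps A R := Fps (fun n => - fpscoef f n).
Definition fps_add f g : fps A R := Fps (fun n => fpscoef f n + fpscoef g n).

Fact fps_addA : associative fps_add.
Proof. by move=> f g h; apply: fpsP => n; apply: addrA. Qed.
Fact fps_addC : commutative fps_add.
Proof. by move=> f g; apply: fpsP => n; apply: addrC. Qed.
Fact fps_add0 : left_id fps0 fps_add.
Proof. by move=> f; apply: fpsP => n; apply: add0r. Qed.
Fact fps_addN : left_inverse fps0 fps_opp fps_add.
Proof. by move=> f; apply: fpsP => n; apply: addNr. Qed.

HB.instance Definition _ :=
  GRing.isZmodule.Build (fps A R) fps_addA fps_addC fps_add0 fps_addN.

Definition fps_const (c : R) : fps A R :=
  Fps (fun n => if n == [ffun=> 0%N] then c else 0).

Definition fps_mul f g : fps A R :=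
  Fps (fun n => \sum_(i <- below n) fpscoef f i * fpscoef g (expB n i)).

Fact fps_mulC : commutative fps_mul.
Proof.
move=> f g; apply: fpsP => n /=; rewrite big_below_rev.
rewrite big_seq [RHS]big_seq; apply: eq_bigr => i ni.
by rewrite expBK // mulrC.
Qed.

Fact fps_mulA : associative fps_mul.
Proof.
move=> f g h; apply: fpsP => n /=.
have -> : \sum_(l <- below n) (\sum_(i <- below l) fpscoef f i *
    fpscoef g (expB l i)) * fpscoef h (expB n l) =
  \sum_(l <- below n) \sum_(i <- below n | i \in below l)
    fpscoef f i * fpscoef g (expB l i) * fpscoef h (expB n l).
  rewrite big_seq [RHS]big_seq; apply: eq_bigr => l nl.
  by rewrite -big_below_sub // mulr_suml.
rewrite (exchange_big_dep xpredT) //= big_seq [RHS]big_seq.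
apply: eq_bigr => i ni; rewrite mulr_sumr -big_below_shift //.
apply: eq_bigr => l /belowP il; rewrite mulrA; congr (_ * fpscoef h _).
apply/ffunP => a; rewrite !ffunE subnBA; last exact: il.
by rewrite subnK //; apply: (belowP _ _ ni).
Qed.

Fact fps_mul1 : left_id (fps_const 1) fps_mul.
Proof.
move=> f; apply: fpsP => n /=.
have n0 : [ffun=> 0%N] \in below n by apply/belowP => a; rewrite ffunE.
rewrite (bigD1_seq _ n0 (below_uniq n)) /= eqxx mul1r big1 ?addr0.
  by congr (fpscoef f _); apply/ffunP => a; rewrite !ffunE subn0.
by move=> i /negPf ->; rewrite mul0r.
Qed.

Fact fps_mulDl : left_distributive fps_mul +%R.
Proof.
move=> f g h; apply: fpsP => n /=; rewrite -big_split /=.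
by apply: eq_bigr => i _; rewrite mulrDl.
Qed.

Fact fps_1_neq0 : fps_const 1 != 0.
Proof.
apply/eqP => /(congr1 (fun f : fps A R => fpscoef f [ffun=> 0%N])) /= /eqP.
by rewrite eqxx oner_eq0.
Qed.

HB.instance Definition _ := GRing.Zmodule_isComNzRing.Build (fps A R)
  fps_mulA fps_mulC fps_mul1 fps_mulDl fps_1_neq0.

Definition fps_unit : {pred fps A R} := fun f => `[< exists g, g * f = 1 >].
Definition fps_inv f : fps A R :=
  if f \in fps_unit then xget f [set g | g * f = 1]%classic else f.

Fact fps_mulVf : {in fps_unit, left_inverse 1 fps_inv *%R}.
Proof.
move=> f uf; rewrite /fps_inv uf; have [g gf1] := asboolP _ uf.
by case: xgetP => [h _ //|/(_ g)/(_ gf1)].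
Qed.

Fact fps_unitPl f g : g * f = 1 -> fps_unit f.
Proof. by move=> gf1; apply/asboolP; exists g. Qed.

Fact fps_inv_out : {in [predC fps_unit], fps_inv =1 id}.
Proof. by move=> f /negPf uf; rewrite /fps_inv uf. Qed.

HB.instance Definition _ := GRing.ComNzRing_hasMulInverse.Build (fps A R)
  fps_mulVf fps_unitPl fps_inv_out.

Definition fpsX (a : A) : fps A R :=
  Fps (fun n => if n == [ffun b => (b == a : nat)] then 1 else 0).

Lemma fpscoefMX a f n : fpscoef (fpsX a * f) n =
  if (0 < n a)%N then fpscoef f (expB n [ffun b => (b == a : nat)]) else 0.
Proof.
rewrite /= -[below n]/(below n); case: ifP => na.
  have nX : [ffun b => (b == a : nat)] \in below n.
    by apply/belowP => b; rewrite ffunE; case: eqP => // ->.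
  rewrite (bigD1_seq _ nX (below_uniq n)) /= eqxx mul1r big1 ?addr0 //.
  by move=> i /negPf ->; rewrite mul0r.
rewrite big_seq big1 // => i /belowP /(_ a); case: eqP => [->|]; rewrite ?mul0r//.
by rewrite ffunE eqxx na.
Qed.

Lemma fps_geomE a : (1 - fpsX a) \is a GRing.unit /\
  (1 - fpsX a)^-1 =
    Fps (fun n => if [forall b, (b != a) ==> (n b == 0%N)] then 1 else 0).
Proof.
set G := Fps _.
have XG : (1 - fpsX a) * G = 1.
  rewrite mulrBl mul1r; apply: fpsP => n.
  change (fpscoef G n - fpscoef (fpsX a * G) n = fpscoef 1 n).
  rewrite fpscoefMX [RHS]/=; case: (ifP (0 < n a)%N) => na.
    suff -> : fpscoef G (expB n [ffun b => (b == a : nat)]) = fpscoef G n.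
      rewrite subrr; case: eqP => // n0.
      by rewrite n0 ffunE in na.
    rewrite /=; congr (if _ then _ else _); apply: eq_forallb => b.
    by rewrite !ffunE; case: eqP => //= _; rewrite subn0.
  rewrite subr0 /=; congr (if _ then _ else _).
  apply/forallP/eqP => [n0|-> b]; last by rewrite ffunE eqxx implybT.
  apply/ffunP => b; rewrite ffunE; case: (eqVneq b a) => [->|ba].
    by apply/eqP; rewrite -leqn0 leqNgt na.
  by apply/eqP/(implyP (n0 b)).
have uX : (1 - fpsX a) \is a GRing.unit.
  by apply/unitrPr; exists G.
by split=> //; apply: (mulrI uX); rewrite XG mulrV.
Qed.

End Fps.

Notation "''z_' a" := (fpsX _ a) (at level 8, a at level 2, format "''z_' a").

(* [edge v u] is the finite type of edges from [v] to [u], so a family [edge]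
   is a finite directed multigraph on [V], loops allowed.  As the [alphabet v]
   and [state v] are nonempty, finiteness of the total alphabet and of the
   total state space amounts to finiteness of each [alphabet v], [state v].
   The alphabets are made disjoint by [letter] below. *)
Record network (V : finType) (edge : V -> V -> finType) := Network {
  alphabet : V -> finType;
  state : V -> finType;
  alphabet_gt0 : forall v, (0 < #|alphabet v|)%N;
  state_gt0 : forall v, (0 < #|state v|)%N;
  trans : forall v, alphabet v -> state v -> state v;
  msg : forall v u, edge v u -> state v -> alphabet v -> seq (alphabet u);
  transC : forall v (a b : alphabet v) (q : state v),
    trans a (trans b q) = trans b (trans a q);
  msgC : forall v u (e : edge v u) (a b : alphabet v) (q : state v),
    perm_eq (msg e q a ++ msg e (trans a q) b)
            (msg e q b ++ msg e (trans b q) a)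
}.

Section Network.
Variables (V : finType) (edge : V -> V -> finType) (N : network edge).

Definition letter : finType := {v : V & alphabet N v}.
Definition gstate : finType := {dffun forall v : V, state N v}.
Definition config : Type := ({ffun letter -> int} * gstate)%type.

Implicit Types (a b : letter) (w : seq letter) (q : gstate) (c : config).

Definition step a q : gstate :=
  finfun (dfwith q (trans (tagged a) (q (tag a)))).

Definition emit a q : {ffun letter -> nat} :=
  [ffun b : letter => \sum_(e : edge (tag a) (tag b))
     count_mem (tagged b) (msg e (q (tag a)) (tagged a))]%N.

Definition fire a c : config :=
  ([ffun b : letter => c.1 b + (emit a c.2 b)%:Z - (b == a)%:Z], step a c.2).

Fixpoint stepw w q : gstate :=
  if w is a :: w' then stepw w' (step a q) else q.

Fixpoint emitw w q : {ffun letter -> nat} :=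
  if w is a :: w' then [ffun b : letter => (emit a q b + emitw w' (step a q) b)%N]
  else [ffun=> 0%N].

Fixpoint firew w c : config :=
  if w is a :: w' then firew w' (fire a c) else c.

Fixpoint legal w c : bool :=
  if w is a :: w' then (1 <= c.1 a) && legal w' (fire a c) else true.

Definition yields c c' : Prop := exists2 w, legal w c & firew w c = c'.

(* [stepw], [emitw] only depend on the letter counts of the word, so evaluating
   them on this word gives their values at a count vector. *)
Definition word_of (n : {ffun letter -> nat}) : seq letter :=
  flatten [seq nseq (n a) a | a <- enum letter].

Definition stepn n q : gstate := stepw (word_of n) q.
Definition emitn n q : {ffun letter -> nat} := emitw (word_of n) q.

Definition locally_irreducible : Prop :=
  forall q q', exists w w', stepw w q = stepw w' q'.

Definition end_comp (f g : {ffun gstate -> gstate}) : {ffun gstate -> gstate} :=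
  [ffun q => f (g q)].
Definition end_id : {ffun gstate -> gstate} := [ffun q => q].

(* The elements of the submonoid generated by the [step a] are the maps
   [stepw w]. *)
Definition step_monoid : {set {ffun gstate -> gstate}} :=
  [set f : {ffun gstate -> gstate} | `[< exists w, forall q, f q = stepw w q >]].

Definition idem_prod : {ffun gstate -> gstate} :=
  \big[end_comp/end_id]_(f in step_monoid | end_comp f f == f) f.

Definition Loc : {set gstate} := [set idem_prod q | q : gstate].

Definition pos_part (z : {ffun letter -> int}) : {ffun letter -> nat} :=
  [ffun a => `|Num.max (z a) 0|%N].
Definition neg_part (z : {ffun letter -> int}) : {ffun letter -> nat} :=
  [ffun a => `|Num.max (- z a) 0|%N].

Definition total_kernel : set {ffun letter -> int} :=
  [set z | forall q, q \in Loc ->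
     stepn (pos_part z) q = stepn (neg_part z) q]%classic.

Definition intvec (n : {ffun letter -> nat}) : {ffun letter -> int} :=
  [ffun a => (n a)%:Z].

Definition is_production_matrix (P : 'M[rat]_#|letter|) : Prop :=
  forall k : {ffun letter -> nat}, total_kernel (intvec k) ->
  forall q, q \in Loc ->
  P *m (\col_i (k (enum_val i))%:R) = \col_i (emitn k q (enum_val i))%:R.

(* When the network is locally irreducible, exactly one matrix satisfies
   [is_production_matrix]. *)
Definition production_matrix : 'M[rat]_#|letter| :=
  xget 0 [set P | is_production_matrix P]%classic.

Definition strongly_connected : Prop :=
  forall a b : letter,
    connect (fun a b => 0 < production_matrix (enum_rank b) (enum_rank a)) a b.

Definition agent_network : Prop :=
  forall a q, (\sum_b emit a q b = 1)%N.

Definition legally_related c1 c2 : Prop :=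
  exists c3, yields c1 c3 /\ yields c2 c3.

Definition recurrent c : Prop :=
  (exists2 w, w != [::] & legal w c) /\
  (forall c', legally_related c' c -> yields c' c).

(* A configuration in Rec(N, n) is determined by its state component. *)
Definition Rec (n : {ffun letter -> nat}) : {set gstate} :=
  [set q | `[< recurrent (intvec n, q) >]].

End Network.

Arguments total_kernel {V edge} N.
Arguments Rec {V edge} N n.

(* The number of cosets x + K (0 if there are infinitely many). *)
Definition subgroup_index (G : zmodType) (K : set G) : nat :=
  #|` fset_set [set [set x + k | k in K] | x in [set: G]]%classic|.

(* Main.v *)
(* The row of I(z) - P indexed by a involves only z_a, so the coefficient of
   z^n in its determinant is det (1 - P'), where P' is P with the rows in the
   support S of n replaced by 0.  If n = 0 this vanishes, as the columns of P sum
   to 1, and no configuration with x = 0 has a nonempty legal execution.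

   Otherwise discard every letter sent to S.  On the locally recurrent states
   this leaves a halting abelian network with production matrix P'; let psi_z(q)
   be the final state when the input z is stabilized at q.  The psi_z form a
   finite commutative monoid, acting on the image R of its smallest idempotent
   as a transitive group, and for q in R one has psi_y(q) = psi_z(q) if and only
   if y - z lies in (1 - P')K.  Hence
     #R = [Z^A : (1 - P')K] = [Z^A : K] det (1 - P').
   Finally n.q is recurrent if and only if q is locally recurrent and lies in R:
   both mean that n.q admits a legal cycle through all letters.  Given such a
   cycle with letter counts k, one has Pk = k, and firing r k - g with
   (1 - P')g large shows that q is in the image of psi_x for large x.
   Conversely, if q is in R, stabilizing the input k restricted to S fires
   exactly k, where k > 0 and Pk = k, and since the number of agents is
   conserved a legal execution from n.q bounded by k can only get stuck at k. *)

Require Import Defs.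
From mathcomp Require Import all_boot all_order all_algebra finmap.
From mathcomp Require Import boolp classical_sets cardinality.
From mathcomp Require Import polyrcf realalg.
From mathcomp Require Import zify ring lra.

Set Implicit Arguments.
Unset Strict Implicit.
Unset Printing Implicit Defensive.

Import Order.TTheory GRing.Theory Num.Theory.

(** The orbit of [x] enters a cycle within [#|T|] steps; the cycle length is at most [#|T|], hence
    divides [m]. So the [m]-th iterate is idempotent. *)
Lemma iter_fact (T : finType) (f : T -> T) (x : T) (m := (#|T|)`!) :
  iter (m + m) f x = iter m f x.
Proof.
have Hm k : (0 < k <= #|T|)%N -> k %| m.
  by move=> /andP[k0 kT]; apply: dvdn_fact; rewrite k0.
have [i [j [ij jT eq_ij]]] : exists i j, [/\ (i < j)%N, (j <= #|T|)%N &
    iter i f x = iter j f x].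
  have : ~~ uniq (traject f x #|T|.+1).
    apply/negP => /card_uniqP; rewrite size_traject => E.
    by have := max_card (mem (traject f x #|T|.+1)); rewrite E ltnn.
  case/(uniqPn x) => i [j [ij]]; rewrite size_traject => jT.
  rewrite !nth_traject ?(ltn_trans ij jT) // => E.
  by exists i, j.
have per k : iter (i + k * (j - i)) f x = iter i f x.
  elim: k => [|k IH]; first by rewrite mul0n addn0.
  by rewrite mulSn addnCA iterD IH -iterD subnK ?eq_ij // ltnW.
have /dvdnP[c mc] : (j - i) %| m by apply: Hm; lia.
have im : (i <= m)%N.
  by have := dvdn_leq (fact_gt0 _) (Hm j ltac:(lia)); rewrite -/m; lia.
have -> : (m + m = (m - i) + (i + c * (j - i)))%N by rewrite -mc; lia.
by rewrite iterD per -iterD subnK.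
Qed.

(** * Words, exchange lemma and stabilization *)

Section Words.
Variables (A : finType) (Q : Type) (t : A -> Q -> Q) (M : A -> Q -> A -> nat).
Hypothesis tC : forall a b q, t a (t b q) = t b (t a q).
Hypothesis MC : forall a b q c,
  (M a q c + M b (t a q) c = M b q c + M a (t b q) c)%N.
Implicit Types (a b : A) (w p m r : seq A) (q : Q) (x y z : A -> nat).

Fixpoint actw w q := if w is a :: w' then actw w' (t a q) else q.

Fixpoint outw w q b : nat :=
  if w is a :: w' then (M a q b + outw w' (t a q) b)%N else 0%N.

Definition cnt w a : nat := count_mem a w.

Lemma cnt_cat w w' a : cnt (w ++ w') a = (cnt w a + cnt w' a)%N.
Proof. exact: count_cat. Qed.

Lemma cnt_cons w a b : cnt (a :: w) b = ((a == b) + cnt w b)%N.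
Proof. by []. Qed.

Lemma cnt_rcons w a b : cnt (rcons w a) b = (cnt w b + (a == b))%N.
Proof. by rewrite -cats1 cnt_cat cnt_cons addn0. Qed.

Lemma cnt_nseq n a b : cnt (nseq n a) b = ((a == b) * n)%N.
Proof. exact: count_nseq. Qed.

Definition word z := flatten [seq nseq (z a) a | a <- enum A].

Lemma cnt_word z a : cnt (word z) a = z a.
Proof.
rewrite /cnt /word count_flatten sumnE !big_map -enumT big_enum /= (bigD1 a) //=.
rewrite count_nseq /= eqxx mul1n big1 ?addn0 // => b /negPf ba.
by rewrite count_nseq /= ba mul0n.
Qed.

Lemma act_cat w w' q : actw (w ++ w') q = actw w' (actw w q).
Proof. by elim: w q => //= a w IH q. Qed.

Lemma out_cat w w' q b : outw (w ++ w') q b = (outw w q b + outw w' (actw w q) b)%N.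
Proof. by elim: w q => //= a w IH q; rewrite IH addnA. Qed.

Lemma act_rem a w q : a \in w -> actw w q = actw (rem a w) (t a q).
Proof.
elim: w q => //= c w IH q; rewrite inE eq_sym; case: eqVneq => [-> //|ca] /= aw.
by rewrite IH //= tC.
Qed.

Lemma out_rem a w q b : a \in w -> outw w q b = (M a q b + outw (rem a w) (t a q) b)%N.
Proof.
elim: w q => //= c w IH q; rewrite inE eq_sym; case: eqVneq => [-> //|ca] /= aw.
by rewrite IH // !addnA MC tC.
Qed.

Lemma act_perm w w' q : perm_eq w w' -> actw w q = actw w' q.
Proof.
elim: w w' q => [|a w IH] w' q eq_w; first by move: eq_w; rewrite perm_sym => /perm_nilP ->.
have aw' : a \in w' by rewrite -(perm_mem eq_w) mem_head.
rewrite (act_rem _ aw') /=; apply: IH.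
by rewrite -(perm_cons a) (perm_trans eq_w) // perm_to_rem.
Qed.

Lemma out_perm w w' q b : perm_eq w w' -> outw w q b = outw w' q b.
Proof.
elim: w w' q => [|a w IH] w' q eq_w; first by move: eq_w; rewrite perm_sym => /perm_nilP ->.
have aw' : a \in w' by rewrite -(perm_mem eq_w) mem_head.
rewrite (out_rem _ _ aw') /=; congr addn; apply: IH.
by rewrite -(perm_cons a) (perm_trans eq_w) // perm_to_rem.
Qed.

Lemma perm_count w w' : (forall a, cnt w a = cnt w' a) -> perm_eq w w'.
Proof. by move=> eq_w; apply/allP => a _ /=; apply/eqP/eq_w. Qed.

Lemma act_count w w' q :
  (forall a, cnt w a = cnt w' a) -> actw w q = actw w' q.
Proof. by move/perm_count/act_perm. Qed.

Lemma out_count w w' q b :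
  (forall a, cnt w a = cnt w' a) -> outw w q b = outw w' q b.
Proof. by move/perm_count/out_perm. Qed.

Lemma actC w w' q : actw w (actw w' q) = actw w' (actw w q).
Proof. by rewrite -!act_cat; apply/act_perm; rewrite perm_catC. Qed.

Lemma out_le w w' q b :
  (forall a, cnt w a <= cnt w' a)%N -> (outw w q b <= outw w' q b)%N.
Proof.
move=> le_w; have -> : outw w' q b =
    outw (w ++ word (fun a => cnt w' a - cnt w a)%N) q b.
  by apply: out_count => a; rewrite cnt_cat cnt_word subnKC.
by rewrite out_cat leq_addr.
Qed.

Lemma cnt_flatten_nseq n w a :
  cnt (flatten (nseq n w)) a = (n * cnt w a)%N.
Proof. by elim: n => //= n IH; rewrite cnt_cat IH mulSn. Qed.

Lemma act_nseq k a q : actw (nseq k a) q = iter k (t a) q.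
Proof. by elim: k q => // k IH q; rewrite iterSr -IH. Qed.

(** Sorting the letters yields blocks [nseq (k * d) a], each of which fixes [q]. *)
Lemma act_dvd d w q : (forall a, iter d (t a) q = q) ->
  (forall a, d %| cnt w a) -> actw w q = q.
Proof.
move=> qd dw; rewrite (@act_count w (word (cnt w))) => [|a]; last by rewrite cnt_word.
rewrite /word; elim: (enum A) => //= a r IH; rewrite act_cat.
have /dvdnP[k ->] := dw a.
suff -> : actw (nseq (k * d) a) q = q by [].
elim: k => // k IHk; rewrite mulSn nseqD act_cat.
by rewrite [actw (nseq d a) q]act_nseq qd.
Qed.

(* [legal_after x q m w]: after firing all of [m], legally or not, from x.q,
   the word [w] is legal. *)
Fixpoint legal_after x q m w : bool :=
  if w is a :: w' then
    (cnt m a < x a + outw m q a)%N && legal_after x q (rcons m a) w'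
  else true.

Lemma legal_after_cat x q m w w' :
  legal_after x q m (w ++ w') = legal_after x q m w && legal_after x q (m ++ w) w'.
Proof.
elim: w m => [|a w IH] m /=; first by rewrite cats0.
by rewrite IH cat_rcons andbA.
Qed.

Lemma legal_after_rcons x q m w a : legal_after x q m (rcons w a) =
  legal_after x q m w && (cnt (m ++ w) a < x a + outw (m ++ w) q a)%N.
Proof. by rewrite -cats1 legal_after_cat /= andbT. Qed.

Lemma legal_after_shift x y q m p w :
  (forall b, x b + cnt m b = y b + outw m q b)%N ->
  legal_after y q (m ++ p) w = legal_after x (actw m q) p w.
Proof.
move=> eq_xy; elim: w p => //= a w IH p; rewrite -cats1 -catA cats1 IH.
congr (_ && _); rewrite cnt_cat out_cat.
by have := eq_xy a; lia.
Qed.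

Lemma legal_after_le x y q m w :
  (forall b, x b <= y b)%N -> legal_after x q m w -> legal_after y q m w.
Proof.
move=> xy; elim: w m => //= a w IH m /andP[aw /IH ->]; rewrite andbT.
by have := xy a; lia.
Qed.

Lemma legal_after_trans x y q m w :
    (forall b, x b + cnt m b <= y b + outw m q b)%N ->
    legal_after y q [::] m -> legal_after x (actw m q) [::] w ->
  legal_after y q [::] (m ++ w).
Proof.
move=> le_xy lm lw; rewrite legal_after_cat lm /= -[m]cats0.
rewrite (@legal_after_shift (fun b => y b + outw m q b - cnt m b)%N).
  by apply: legal_after_le lw => b; have := le_xy b; lia.
by move=> b; have := le_xy b; lia.
Qed.

Lemma out_flatten_nseq k w q b : actw w q = q ->
  outw (flatten (nseq k w)) q b = (k * outw w q b)%N.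
Proof. by move=> wq; elim: k => //= k IH; rewrite out_cat wq IH mulSn. Qed.

Lemma act_flatten_nseq k w q : actw w q = q -> actw (flatten (nseq k w)) q = q.
Proof. by move=> wq; elim: k => //= k IH; rewrite act_cat wq. Qed.

(** Letters of [w] in which [m'] is already ahead of [m] are skipped. Any other letter has been
    fired equally often on both sides, while by [out_le] the word [m'] has emitted at least as many
    copies of it, so it stays legal. *)
Lemma exchange x q m m' w :
    (forall b, cnt m b <= cnt m' b)%N -> legal_after x q m w ->
  exists2 w', legal_after x q m' w' & forall b,
    cnt (m' ++ w') b = maxn (cnt (m ++ w) b) (cnt m' b).
Proof.
elim: w m m' => [|a w IH] m m' mm' /=.
  by exists [::] => // b; rewrite !cats0; have := mm' b; lia.
case/andP => am lw; have [lt_a|le_a] := ltnP (cnt m a) (cnt m' a).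
  have [|w' lw' Ew'] := IH (rcons m a) m' _ lw.
    by move=> b; rewrite cnt_rcons; case: eqVneq => [<-|_]; have := mm' b; lia.
  by exists w' => // b; rewrite Ew' cat_rcons.
have [|w' lw' Ew'] := IH (rcons m a) (rcons m' a) _ lw.
  by move=> b; rewrite !cnt_rcons leq_add2r.
exists (a :: w') => /= [|b].
  by rewrite lw' andbT; have := out_le q a mm'; lia.
rewrite -cat_rcons Ew' cat_rcons !cnt_cat /= cnt_rcons.
by case: eqVneq => [<-|_]; rewrite /=; have := mm' a; have := mm' b; lia.
Qed.

(** The word [m] need not be legal. Once [p] has fired [a] as often as [m], it has received at most
    as many [a] by monotonicity of [outw], so none is pending and [a] cannot be fired legally. *)
Lemma least_action x q p m w :
    (forall b, x b + outw m q b <= cnt m b)%N -> legal_after x q p w ->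
    (forall b, cnt p b <= cnt m b)%N ->
  forall b, (cnt (p ++ w) b <= cnt m b)%N.
Proof.
move=> stab_m; elim: w p => [|a w IH] p /=; first by rewrite cats0.
case/andP => ap lw pm; rewrite -cat_rcons; apply: IH => // b.
rewrite cnt_rcons; have := pm b; case: eqVneq => [<-|_]; last by lia.
by have := out_le q a pm; have := stab_m a; lia.
Qed.

Lemma legal_le x q w : legal_after x q [::] w ->
  forall b, (cnt w b <= x b + outw w q b)%N.
Proof.
elim/last_ind: w => [|w a IH] // => lw b.
move: lw; rewrite legal_after_rcons /= => /andP[/IH/(_ b) lew aw].
rewrite -{2}cats1 out_cat /= addn0 cnt_rcons.
by case: eqVneq aw => [->|_] aw; lia.
Qed.

Lemma legal_of_le x q w : (forall b, cnt w b <= x b)%N ->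
  legal_after x q [::] w.
Proof.
elim/last_ind: w => [|w a IH] // => lew; rewrite legal_after_rcons /= IH.
  by have := lew a; rewrite cnt_rcons eqxx; lia.
by move=> b; have := lew b; rewrite cnt_rcons; lia.
Qed.

(** * Stabilization of halting networks *)

Section Stabilization.
Hypothesis halting : forall z q,
  exists m, forall b, (z b + outw m q b <= cnt m b)%N.

(** Least action bounds the lengths of legal words by [size m]; a longest one cannot be extended, so
    it leaves nothing pending. *)
Lemma stab_exists z q : exists w, legal_after z q [::] w &&
  [forall b, cnt w b == (z b + outw w q b)%N].
Proof.
have [m stab_m] := halting z q.
pose P k := [exists w : k.-tuple A, legal_after z q [::] w].
have bound k : P k -> (k <= size m)%N.
  case/existsP => w lw; rewrite -[k in (k <= _)%N](size_tuple w).
  have le_wm : forall b, (cnt w b <= cnt m b)%N.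
    exact: (least_action stab_m lw).
  have -> : size m = size (w ++ word (fun a => cnt m a - cnt w a)%N).
    by apply/perm_size/perm_count => a; rewrite cnt_cat cnt_word subnKC.
  by rewrite size_cat leq_addr.
have P0 : exists k, P k by exists 0%N; apply/existsP; exists [tuple].
have [k /existsP[w lw] maxk] := ex_maxnP P0 bound.
exists w; rewrite lw /=; apply/forallP => b; rewrite eqn_leq legal_le //=.
rewrite leqNgt; apply/negP => wb.
suff /maxk : P k.+1 by rewrite ltnn.
apply/existsP; exists [tuple of rcons w b].
by rewrite /= legal_after_rcons lw.
Qed.

Definition odometer z q := xchoose (stab_exists z q).
Definition stab z q := actw (odometer z q) q.

Lemma odometer_legal z q : legal_after z q [::] (odometer z q).
Proof. by case/andP: (xchooseP (stab_exists z q)). Qed.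

Lemma odometerE z q b :
  cnt (odometer z q) b = (z b + outw (odometer z q) q b)%N.
Proof. by case/andP: (xchooseP (stab_exists z q)) => _ /forallP/(_ b)/eqP. Qed.

Lemma le_odometer z q w : legal_after z q [::] w ->
  forall b, (cnt w b <= cnt (odometer z q) b)%N.
Proof. by move=> lw; apply: (least_action _ lw) => // b; rewrite odometerE. Qed.

Lemma odometer_uniq z q w : legal_after z q [::] w ->
    (forall b, cnt w b = z b + outw w q b)%N ->
  forall b, cnt (odometer z q) b = cnt w b.
Proof.
move=> lw Ew b; apply/eqP; rewrite eqn_leq le_odometer // andbT.
by apply: (least_action _ (odometer_legal z q)) => // c; rewrite Ew.
Qed.

Lemma stab_uniq z q w : legal_after z q [::] w ->
    (forall b, cnt w b = z b + outw w q b)%N ->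
  stab z q = actw w q.
Proof. by move=> lw Ew; apply: act_count; apply: odometer_uniq. Qed.

Lemma stab_eq z y q : z =1 y -> stab z q = stab y q.
Proof.
move=> zy; apply: stab_uniq => [|b]; last by rewrite odometerE zy.
by apply: legal_after_le (odometer_legal _ _) => b; rewrite zy.
Qed.

(** The odometer of [x], followed by that of [y] at the new state, is legal for the sum and leaves
    nothing pending; uniqueness applies. *)
Lemma stabD z x y q : (forall b, z b = x b + y b)%N ->
  stab z q = stab y (stab x q).
Proof.
move=> zE; rewrite {2}/stab /stab -act_cat; apply: stab_uniq => [|b].
  rewrite legal_after_cat /=; apply/andP; split.
    by apply: legal_after_le (odometer_legal _ _) => b; rewrite zE leq_addr.
  rewrite -[odometer x q]cats0 (@legal_after_shift y) ?odometer_legal //.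
    by rewrite ?cats0; apply: odometer_legal.
  by move=> b; rewrite zE odometerE; lia.
by rewrite cnt_cat out_cat !odometerE zE; lia.
Qed.

Lemma stab0 z q : z =1 (fun=> 0%N) -> stab z q = q.
Proof. by move=> z0; rewrite (stab_uniq (w := [::])) // => b; rewrite z0. Qed.

(** The exchange lemma, started from the empty word, completes [m] to the odometer by a word legal
    after [m]; [m] itself may be illegal. *)
Lemma stab_fire z x q m :
    (forall b, cnt m b <= cnt (odometer z q) b)%N ->
    (forall b, x b + cnt m b = z b + outw m q b)%N ->
  stab z q = stab x (actw m q).
Proof.
move=> le_m xE; have m0 : forall b, (cnt [::] b <= cnt m b)%N by [].
have [w lw Ew] := exchange m0 (odometer_legal z q).
have mwE b : cnt (m ++ w) b = cnt (odometer z q) b.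
  by rewrite Ew /=; have := le_m b; lia.
rewrite (@stab_uniq x _ w) => [||b].
- by rewrite -act_cat; apply: act_count => b; rewrite mwE.
- by move: lw; rewrite -{1}[m]cats0 (legal_after_shift _ _ xE).
have := mwE b; rewrite odometerE -(out_count _ _ mwE) out_cat cnt_cat.
by have := xE b; lia.
Qed.

Lemma stab_fire_le z x q m : (forall b, cnt m b <= z b)%N ->
    (forall b, x b + cnt m b = z b + outw m q b)%N ->
  stab z q = stab x (actw m q).
Proof.
by move=> mz xE; apply: stab_fire => //; apply/le_odometer/legal_of_le.
Qed.

End Stabilization.
End Words.

Arguments cnt {A} w a : simpl never.

Local Open Scope ring_scope.

(** * Counting cosets *)

(** The cosets of [K] are the fibres of [f], one for each element of [R]. *)
Lemma subgroup_index_fibers (G : zmodType) (X : finType) (R : {set X})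
    (K : set G) (f : G -> X) :
    (forall z, f z \in R) -> (forall r, r \in R -> exists z, f z = r) ->
    (forall y z, f y = f z <-> K (y - z)) ->
  subgroup_index K = #|R|.
Proof.
move=> fR f_onto fK; rewrite /subgroup_index.
pose fib r := [set z | f z = r]%classic.
have cosetE y : [set y + k | k in K]%classic = fib (f y).
  apply/seteqP; split => [z [k Kk <-]|z /fK Kzy].
    by apply/fK; rewrite addrAC subrr add0r.
  by exists (z - y) => //; rewrite addrC subrK.
have -> : ([set [set x + k | k in K] | x in [set: G]] =
    [set` seq_fset tt (map fib (enum R))])%classic.
  apply/seteqP; split => [_ [z _ <-]|B /= BF].
    rewrite cosetE; suff: fib (f z) \in seq_fset tt (map fib (enum R)) by [].
    by rewrite seq_fsetE; apply/mapP; exists (f z); rewrite ?mem_enum.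
  have: B \in seq_fset tt (map fib (enum R)) by [].
  rewrite seq_fsetE => /mapP[r]; rewrite mem_enum => /f_onto[z <-] ->.
  by exists z => //; rewrite cosetE.
rewrite set_fsetK cardfE cardE; transitivity (size (undup (map fib (enum R)))).
  by rewrite -cardfE -(size_seq_fset tt).
rewrite undup_id ?size_map // map_inj_in_uniq ?enum_uniq // => r s.
rewrite !mem_enum => /f_onto[z <-] _ eq_fib.
by suff : fib s z by []; rewrite -eq_fib.
Qed.

Section Torsor.
Variables (A Q : finType) (psi : (A -> nat) -> Q -> Q).
Hypothesis psi_eq : forall y z q, y =1 z -> psi y q = psi z q.
Hypothesis psiD : forall z x y q, (forall b, z b = x b + y b)%N ->
  psi z q = psi y (psi x q).
Hypothesis psi0 : forall z q, z =1 (fun=> 0%N) -> psi z q = q.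

Let m := (#|Q|)`!.

(** The image of the smallest idempotent: this map is idempotent by [iter_fact], and any idempotent
    [psi z] equals [psi] of [m * z], which fixes this image by [stable_image_period]. *)
Definition stable_image : {set Q} := [set psi (fun=> m) q | q in setT].
Local Notation R := stable_image.

Let psiC x y q : psi x (psi y q) = psi y (psi x q).
Proof. by rewrite -!(@psiD (fun b => x b + y b)%N) // => b; rewrite addnC. Qed.

Let psi_iter k z q : psi (fun b => k * z b)%N q = iter k (psi z) q.
Proof.
elim: k => [|k IH]; first by rewrite psi0.
by rewrite iterS -IH (@psiD _ (fun b => k * z b)%N z) // => b; rewrite mulSn addnC.
Qed.

Let psi_idem z q : psi (fun b => m * z b)%N (psi (fun b => m * z b)%N q)
  = psi (fun b => m * z b)%N q.
Proof. by rewrite !psi_iter -iterD iter_fact. Qed.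

Lemma stable_image_fix q k : q \in R -> psi (fun=> k * m)%N q = q.
Proof.
case/imsetP => p _ ->; rewrite (psi_iter k (fun=> m)).
elim: k => //= k ->; have := psi_idem (fun=> 1%N) p.
by rewrite !(@psi_eq (fun=> m * 1)%N (fun=> m)) // => b; rewrite muln1.
Qed.

(** A large constant multiple of [m] fixes [q] and can be split so that [m * z] acts last; so [q]
    lies in the image of the idempotent with input [m * z]. *)
Lemma stable_image_period q z : q \in R -> psi (fun b => m * z b)%N q = q.
Proof.
move=> qR; pose k := (\sum_b z b)%N.
have E : psi (fun=> k * m)%N q = psi (fun b => m * z b)%N (psi (fun b => m * (k - z b))%N q).
  apply: psiD => b; rewrite -mulnDr subnK ?(mulnC m) // /k (bigD1 b) //=.
  exact: leq_addr.
by rewrite -{1}(stable_image_fix k qR) E psi_idem -E stable_image_fix.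
Qed.

Lemma stable_image_psi q z : q \in R -> psi z q \in R.
Proof.
by case/imsetP => p _ ->; apply/imsetP; exists (psi z p); rewrite ?inE // psiC.
Qed.

Lemma stable_imageP q x : (forall b, m <= x b)%N -> psi x q \in R.
Proof.
move=> mx; apply/imsetP; exists (psi (fun b => x b - m)%N q); rewrite ?inE //.
by rewrite -(@psiD x) // => b; rewrite subnK.
Qed.

Section Count.
Variable L : set {ffun A -> int}.
Hypothesis L_sub : forall y z, L y -> L z -> L (y - z).
Hypothesis psi_L : forall (y z : A -> nat) q, q \in R ->
  (psi y q = psi z q <-> L [ffun b => (y b)%:Z - (z b)%:Z]).
Hypothesis psi_conn : forall p q, exists y z, psi y p = psi z q.
Variable q0 : Q.

(** Multiples of [m] act trivially on [R], so reduction modulo [m] extends the action to all integer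
    vectors. It is transitive with stabilizer [L]. *)
Lemma torsor_index : subgroup_index L = #|R|.
Proof.
have m_gt0 : (0 < m)%N by apply: fact_gt0.
have [r0 r0R] : exists r0, r0 \in R.
  by exists (psi (fun=> m) q0); apply/imsetP; exists q0; rewrite ?inE.
pose red (z : {ffun A -> int}) b := `|(z b %% m)%Z|%N.
have redE (z : {ffun A -> int}) b : (red z b)%:Z = z b - (z b %/ m)%Z * m.
  by rewrite /red gez0_abs ?modz_ge0 ?pnatr_eq0 -?lt0n // {2}(divz_eq (z b) m) addrC addrK.
have L0 : L 0.
  suff -> : 0 = [ffun b : A => (0%N)%:Z - (0%N)%:Z] by apply/(psi_L _ _ r0R).
  by apply/ffunP => b; rewrite !ffunE.
have L_opp y : L y -> L (- y) by rewrite -sub0r; apply: L_sub.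
have L_add y z : L y -> L z -> L (y + z).
  by move=> Ly /L_opp Lz; rewrite -[z]opprK; apply: L_sub.
have Lm (c : {ffun A -> int}) : L [ffun b => c b * m].
  have Lpos (y : A -> nat) : L [ffun b => (m * y b)%:Z].
    have := stable_image_period y r0R; rewrite -[in RHS](psi0 (z := fun=> 0%N) r0) //.
    move/(psi_L _ _ r0R); congr L; apply/ffunP => b.
    by rewrite !ffunE subr0.
  suff -> : [ffun b => c b * m] = [ffun b => (m * `|Num.max (c b) 0|)%N%:Z]
      - [ffun b => (m * `|Num.max (- c b) 0|)%N%:Z] :> {ffun A -> int}.
    exact: L_sub.
  apply/ffunP => b; rewrite !ffunE; lia.
apply: (@subgroup_index_fibers _ _ _ _ (fun z => psi (red z) r0)) => [z|r rR|y z].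
- exact: stable_image_psi.
- have [y [z yz]] := psi_conn r0 r.
  (* Another [m.-1] copies of [z] turn [psi z r] into [psi] of [m * z] at [r], which is [r]. *)
  pose u b := (y b + (m.-1) * z b)%N.
  have Er : r = psi u r0.
    rewrite (@psiD _ y (fun b => m.-1 * z b)%N) // yz -(@psiD (fun b => m * z b)%N).
      by rewrite stable_image_period.
    by move=> b; rewrite -{1}(prednK m_gt0) mulSn.
  exists [ffun b => (u b)%:Z]; rewrite Er; apply/(psi_L _ _ r0R).
  rewrite (_ : [ffun b => _] = [ffun b => [ffun b => - ((u b)%:Z %/ m)%Z] b * m]) //.
  by apply/ffunP => b; rewrite !ffunE redE ffunE addrAC subrr add0r mulNr.
- rewrite (psi_L _ _ r0R).
  set d := [ffun b => ((y b %/ m)%Z - (z b %/ m)%Z)] : {ffun A -> int}.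
  have -> : [ffun b => (red y b)%:Z - (red z b)%:Z] = y - z - [ffun b => d b * m].
    by apply/ffunP => b; rewrite ?/d !ffunE !redE; ring.
  split=> [Lyz|Lyz]; last exact: L_sub.
  by rewrite -(subrK [ffun b => d b * m] (y - z)); apply: L_add.
Qed.

End Count.
End Torsor.

(** * Stochastic matrices *)

Lemma det_neq0_of_kernel (F : fieldType) n (B : 'M[F]_n) :
  (forall v : 'cV_n, B *m v = 0 -> v = 0) -> \det B != 0.
Proof.
move=> ker0; apply/negP; rewrite -det_tr => /det0P[v v0 vB].
case/negP: v0; apply/eqP/(can_inj (@trmxK _ _ _)); rewrite trmx0; apply: ker0.
by apply: (can_inj (@trmxK _ _ _)); rewrite trmx_mul trmxK vB trmx0.
Qed.

Lemma kernel_of_det0 (F : fieldType) n (B : 'M[F]_n) :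
  \det B = 0 -> exists2 v : 'cV_n, v != 0 & B *m v = 0.
Proof.
move=> /eqP; rewrite -det_tr => /det0P[v v0 vB]; exists v^T.
  by apply: contraNneq v0 => v0; rewrite -[v]trmxK v0 trmx0.
by apply: (can_inj (@trmxK _ _ _)); rewrite trmx_mul trmxK vB trmx0.
Qed.

(* As [t] goes from 0 to 1, det (1 - t P) starts at 1 and cannot vanish before
   [t = 1], since then [t P] is a contraction for the l1 norm. *)
Lemma det_substochastic_ge0_rcf (F : rcfType) n (P : 'M[F]_n) :
    (forall i j, 0 <= P i j) -> (forall j, \sum_i P i j <= 1) ->
  0 <= \det (1%:M - P).
Proof.
move=> P0 P1.
have det_neq0 t : 0 <= t < 1 -> \det (1%:M - t *: P) != 0.
  move=> /andP[t0 t1]; apply: det_neq0_of_kernel => v.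
  rewrite mulmxBl mul1mx => /eqP; rewrite subr_eq0 => /eqP vE.
  have vi i : v i 0 = t * \sum_j P i j * v j 0.
    by rewrite {1}vE -scalemxAl !mxE.
  pose s := \sum_i `|v i 0|.
  have s_le : s <= t * s.
    rewrite /s; apply: le_trans (_ : \sum_i t * \sum_j P i j * `|v j 0| <= _).
      apply: ler_sum => i _; rewrite {1}vi normrM ger0_norm // ler_wpM2l //.
      apply: le_trans (ler_norm_sum _ _ _) _; apply: ler_sum => j _.
      by rewrite normrM ger0_norm.
    rewrite -mulr_sumr ler_wpM2l // exchange_big /=; apply: ler_sum => j _.
    by rewrite -mulr_suml ler_piMl.
  have s0 : s = 0.
    apply/eqP; rewrite eq_le sumr_ge0 // andbT.
    have : (1 - t) * s <= 0 by lra.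
    by rewrite pmulr_rle0 // subr_gt0.
  apply/matrixP => i j; rewrite ord1 mxE; apply/eqP; rewrite -normr_eq0.
  by apply/eqP; apply: (psumr_eq0P (fun i _ => normr_ge0 (v i 0)) s0).
rewrite leNgt; apply/negP => det_lt0.
pose q := \det (1%:M - 'X *: map_mx polyC P).
have qE t : q.[t] = \det (1%:M - t *: P).
  rewrite /q -[LHS]/(horner_eval t _) -det_map_mx; congr (\det _).
  apply/matrixP => i j; rewrite !mxE /= /horner_eval hornerD hornerN hornerM.
  by rewrite hornerX hornerC; case: eqP => _; rewrite ?hornerE.
have q0 : q.[0] = 1 by rewrite qE scale0r subr0 det1.
have q1 : q.[1] < 0 by rewrite qE scale1r.
have [|x /andP[x0 x1] rx] := @poly_ivt F (- q) 0 1 ler01.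
  by rewrite !hornerN q0 lerN10 oppr_ge0 ltW.
move: rx; rewrite /root hornerN oppr_eq0 => qx.
have xlt1 : x < 1.
  by rewrite lt_neqAle x1 andbT; apply: contraTneq qx => ->; rewrite lt_eqF.
by have := det_neq0 x; rewrite x0 xlt1 -qE qx => /(_ isT).
Qed.

(** The intermediate value argument takes place over the real algebraic numbers. *)
Lemma det_substochastic_ge0 n (P : 'M[rat]_n) :
    (forall i j, 0 <= P i j) -> (forall j, \sum_i P i j <= 1) ->
  0 <= \det (1%:M - P).
Proof.
move=> P0 P1; rewrite -(ler_rat realalg) rmorph0 -det_map_mx.
rewrite map_mxD map_mxN map_mx1; apply: det_substochastic_ge0_rcf => [i j|j].
  by rewrite mxE ler0q.
under eq_bigr do rewrite mxE.
by rewrite -rmorph_sum -(rmorph1 (ratr : rat -> realalg)) ler_rat.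
Qed.

Section Stochastic.
Variables (A : finType) (p : A -> A -> rat).
Hypothesis p_ge0 : forall b a, 0 <= p b a.
Hypothesis p_sum : forall a, \sum_b p b a = 1.
Hypothesis p_conn : forall a b, connect (fun a b => 0 < p b a) a b.
Implicit Types (h k : A -> rat) (T : pred A).

Lemma closed_full T a b :
  (forall c d, T c -> 0 < p d c -> T d) -> T a -> T b.
Proof.
move=> clT Ta; have /connectP[s] := p_conn a b.
elim: s a Ta => [|c s IH] a Ta /=; first by move=> _ ->.
by case/andP => ac; apply: IH; apply: clT ac.
Qed.

Section Killed.
Variable S : pred A.

(* The production matrix once the letters sent to S are discarded. *)
Definition killed b a : rat := if S b then 0 else p b a.

Lemma killed_ge0 b a : 0 <= killed b a.
Proof. by rewrite /killed; case: ifP. Qed.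

Lemma killed_le b a : killed b a <= p b a.
Proof. by rewrite /killed; case: ifP. Qed.

(** This is (1 - P')h, with P' the matrix [killed]. *)
Definition drift h b : rat := h b - \sum_a killed b a * h a.

Lemma driftB h k b : drift (fun a => h a - k a) b = drift h b - drift k b.
Proof.
rewrite /drift; under eq_bigr do rewrite mulrBr.
by rewrite big_split /= sumrN; ring.
Qed.

Lemma driftM c h b : drift (fun a => c * h a) b = c * drift h b.
Proof.
rewrite /drift mulrBr mulr_sumr; congr (_ - _).
by apply: eq_bigr => a _; ring.
Qed.

Lemma eq_drift h k b : h =1 k -> drift h b = drift k b.
Proof. by move=> hk; rewrite /drift hk; congr (_ - _); apply: eq_bigr => a _; rewrite hk. Qed.

(* Summing the hypothesis over the set where [h < 0] shows that this set is
   closed under [p], and that nothing is killed on it. *)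
Lemma neg_closed h a b : (forall c, 0 <= drift h c) ->
  h a < 0 -> 0 < p b a -> (h b < 0) && ~~ S b.
Proof.
move=> h_drift ha pba; apply: contraTT pba => Tb; rewrite -leNgt.
pose T c := h c < 0; pose c x := \sum_(y | T y) killed y x.
have c_le1 x : c x <= 1.
  rewrite -(p_sum x) (bigID T) /= ler_wpDr ?sumr_ge0 //.
  by apply: ler_sum => y _; apply: killed_le.
have sum1 : 0 <= \sum_(y | T y) (h y - \sum_x killed y x * h x).
  by apply: sumr_ge0 => y _; apply: h_drift.
have sum2 : \sum_(y | T y) (h y - \sum_x killed y x * h x)
    <= \sum_(x | T x) h x * (1 - c x).
  rewrite big_split /= sumrN exchange_big /= [X in _ - X](bigID T) /=.
  under [X in _ <= X]eq_bigr do rewrite mulrBr mulr1.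
  rewrite [X in _ <= X]big_split /= sumrN lerD2l lerN2.
  rewrite -[X in X <= _]addr0 lerD //.
    by apply: ler_sum => x _; rewrite /c mulrC mulr_suml.
  apply: sumr_ge0 => x; rewrite /T -leNgt => hx.
  by apply: sumr_ge0 => y _; rewrite mulr_ge0 ?killed_ge0.
have c1 x : T x -> c x = 1.
  move=> Tx; have term0 y : T y -> 0 <= - (h y * (1 - c y)).
    by move=> Ty; rewrite oppr_ge0 mulr_le0_ge0 ?subr_ge0 ?c_le1 // ltW.
  have : \sum_(y | T y) - (h y * (1 - c y)) = 0.
    apply/eqP; rewrite eq_le sumr_ge0 // andbT sumrN oppr_le0.
    exact: le_trans sum1 sum2.
  move/(psumr_eq0P term0)/(_ x Tx)/eqP; rewrite oppr_eq0 mulf_eq0 (lt_eqF Tx) /=.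
  by rewrite subr_eq0 eq_sym => /eqP.
have : \sum_y (p y a - (if T y then killed y a else 0)) = 0.
  by rewrite big_split /= sumrN p_sum -big_mkcond /= -/(c a) c1 ?subrr.
move/psumr_eq0P => /(_ _ b isT) => pb.
have {}pb : p b a - (if T b then killed b a else 0) = 0.
  by apply: pb => y _; rewrite subr_ge0; case: ifP; rewrite ?killed_le.
move: pb; rewrite /killed; move: Tb; rewrite negb_and negbK.
rewrite /T; case: (h b < 0) => /= [-> | _]; rewrite subr0 => -> //.
Qed.

(** By [neg_closed] a negative value would spread along the strongly connected graph to [s], where
    letters are killed. *)
Lemma drift_ge0 h s : S s -> (forall c, 0 <= drift h c) -> forall b, 0 <= h b.
Proof.
move=> Ss h_drift a; rewrite leNgt; apply/negP => ha.
(* [neg_closed] excludes only successors from [S], so propagation starts at a successor of [a]. *)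
have [b pba] : exists b, 0 < p b a.
  apply: contrapT => no_b; have : \sum_b p b a <= 0.
    by apply: sumr_le0 => b _; rewrite leNgt; apply/negP => ?; case: no_b; exists b.
  by rewrite p_sum ler10.
suff : (h s < 0) && ~~ S s by rewrite Ss andbF.
apply: (@closed_full (fun b => (h b < 0) && ~~ S b) b s) => [c d /andP[hc _]|].
  exact: neg_closed.
exact: neg_closed pba.
Qed.

Lemma drift_inj h k s : S s -> (forall c, drift h c = drift k c) -> h =1 k.
Proof.
move=> Ss hk b; apply/eqP; rewrite eq_le -subr_ge0 -(subr_ge0 (k b)).
rewrite (@drift_ge0 (fun a => k a - h a) s) // => [|c]; last by rewrite driftB hk subrr.
by rewrite (@drift_ge0 (fun a => h a - k a) s) // => c; rewrite driftB hk subrr.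
Qed.

Definition drift_mx : 'M[rat]_#|A| :=
  1%:M - \matrix_(i, j) killed (enum_val i) (enum_val j).

Lemma sum_enum_val (F : A -> rat) : \sum_(i < #|A|) F (enum_val i) = \sum_a F a.
Proof. by rewrite [RHS](reindex _ (onW_bij _ (enum_val_bij A))). Qed.

Lemma drift_mxE h i : (drift_mx *m \col_j h (enum_val j)) i 0 = drift h (enum_val i).
Proof.
rewrite mulmxBl mul1mx !mxE /drift; congr (_ - _); rewrite -sum_enum_val.
by apply: eq_bigr => j _; rewrite !mxE.
Qed.

Lemma det_drift_ge0 : 0 <= \det drift_mx.
Proof.
apply: det_substochastic_ge0 => [i j|j]; first by rewrite mxE killed_ge0.
rewrite -(p_sum (enum_val j)) -sum_enum_val; apply: ler_sum => i _.
by rewrite mxE killed_le.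
Qed.

Lemma det_drift_neq0 s : S s -> \det drift_mx != 0.
Proof.
move=> Ss; apply: det_neq0_of_kernel => v Dv.
pose h a := v (enum_rank a) 0.
have vE : v = \col_j h (enum_val j).
  by apply/matrixP => i j; rewrite ord1 mxE /h enum_valK.
have h0 : h =1 (fun=> 0).
  apply: (drift_inj Ss) => c.
  have := congr1 (fun M : 'cV_ _ => M (enum_rank c) 0) Dv.
  rewrite [in X in X -> _]vE drift_mxE enum_rankK mxE => ->.
  by rewrite /drift big1 ?subr0 // => a _; rewrite mulr0.
by apply/matrixP => i j; rewrite vE !mxE h0.
Qed.

Lemma drift_onto s (y : A -> rat) : S s -> exists h, drift h =1 y.
Proof.
move=> Ss; have uD : drift_mx \in unitmx by rewrite unitmxE unitfE (det_drift_neq0 Ss).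
pose v := invmx drift_mx *m \col_j y (enum_val j).
exists (fun a => v (enum_rank a) 0) => b.
have := drift_mxE (fun a => v (enum_rank a) 0) (enum_rank b); rewrite enum_rankK => <-.
rewrite (_ : \col_j _ = v); first by rewrite mulKVmx // mxE enum_rankK.
by apply/matrixP => i j; rewrite ord1 mxE enum_valK.
Qed.

End Killed.

Lemma common_denominator (h : A -> rat) : exists2 N : nat, (0 < N)%N &
  exists z : A -> int, forall a, N%:R * h a = (z a)%:~R.
Proof.
exists (\prod_a `|denq (h a)|)%N.
  by rewrite prodn_gt0 // => a; rewrite absz_gt0 denq_neq0.
exists (fun a => (\prod_(b | b != a) `|denq (h b)|)%N%:Z * numq (h a)) => a.
rewrite (bigD1 a) //= mulnC natrM -mulrA intrM; congr (_ * _).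
by rewrite numqE mulrC natr_absz gtr0_norm ?denq_gt0.
Qed.

(** The solution of (1 - P')h = 1 is nonnegative, and clearing denominators multiplies its drift by
    a positive integer. *)
Lemma drift_pos (S : pred A) s : S s -> exists g : A -> nat,
  forall b, 1 <= drift S (fun a => (g a)%:R) b.
Proof.
move=> Ss; have [h hE] := drift_onto (fun=> 1) Ss.
have h0 : forall b, 0 <= h b by apply: (drift_ge0 Ss) => c; rewrite hE.
have [N N0 [z zE]] := common_denominator h.
exists (fun a => `|z a|%N) => b.
rewrite (@eq_drift _ _ (fun a => N%:R * h a)) => [|a].
  by rewrite driftM hE mulr1 ler1n.
by rewrite zE natr_absz ger0_norm // -(ler0z rat) -zE mulr_ge0.
Qed.

(** The support of [k] is closed under [p], as [k d] is at least [p d c * k c]. *)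
Lemma perron_pos k a0 : (forall a, 0 <= k a) -> k a0 != 0 ->
  (forall b, \sum_a p b a * k a = k b) -> forall a, 0 < k a.
Proof.
move=> k0 ka0 kE a; rewrite lt_neqAle k0 andbT eq_sym.
apply: (@closed_full (fun b => k b != 0) a0 a) => // c d kc pdc.
rewrite gt_eqF // -kE (bigD1 c) //= ltr_pwDl ?sumr_ge0 //.
  by rewrite mulr_gt0 // lt_neqAle eq_sym kc k0.
by move=> x _; rewrite mulr_ge0.
Qed.

(** With nothing killed the columns sum to 1, so the all-ones row is a left null vector. *)
Lemma det_drift_eq0 (S : pred A) (a0 : A) :
  (forall a, ~~ S a) -> \det (drift_mx S) = 0.
Proof.
move=> S0; apply/eqP/det0P; exists (const_mx 1).
  by apply/eqP => /matrixP/(_ 0 (enum_rank a0))/eqP; rewrite !mxE oner_eq0.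
apply/matrixP => i j; rewrite mulmxBr mulmx1 !mxE (ord1 i).
under eq_bigr do rewrite !mxE mul1r /killed (negPf (S0 _)).
by rewrite (sum_enum_val (fun b => p b _)) p_sum subrr.
Qed.

(** As det (1 - P) = 0, P fixes a nonzero rational vector; irreducibility gives it constant sign,
    and denominators are cleared. *)
Lemma perron (a0 : A) : exists2 k : A -> nat, (forall a, 0 < k a)%N &
  forall b, \sum_a p b a * (k a)%:R = (k b)%:R.
Proof.
pose S : pred A := pred0.
have drift0E k b : drift S k b = k b - \sum_a p b a * k a by [].
have det0 : \det (drift_mx S) = 0 by apply: det_drift_eq0.
have [v v0 Dv] := kernel_of_det0 det0.
pose h a := v (enum_rank a) 0.
have vE : v = \col_j h (enum_val j).
  by apply/matrixP => i j; rewrite ord1 mxE /h enum_valK.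
have h_drift c : drift S h c = 0.
  have := congr1 (fun M : 'cV_ _ => M (enum_rank c) 0) Dv.
  by rewrite [in X in X -> _]vE drift_mxE enum_rankK mxE.
have [a1 ha1] : exists a, h a != 0.
  apply/existsP; apply: contraNT v0 => /existsPn h0.
  apply/eqP/matrixP => i j; rewrite vE !mxE; apply/eqP.
  by have := h0 (enum_val i); rewrite negbK.
have [k [k0 ka1 kE]] : exists k : A -> rat,
    [/\ forall a, 0 <= k a, k a1 != 0 & forall b, drift S k b = 0].
  (* With empty [S], [neg_closed] spreads one negative entry to all entries, and then [- h]
     serves. *)
  have [neg|nneg] := pickP (fun a => h a < 0); last first.
    by exists h; split=> // a; rewrite leNgt nneg.
  exists (fun a => - h a); split=> [a||b]; rewrite ?oppr_eq0 //.
    rewrite oppr_ge0 ltW //; apply: (@closed_full (fun b => h b < 0) neg) => // c d hc pdc.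
    have h_ge0 c' : 0 <= drift S h c' by rewrite h_drift.
    by case/andP: (neg_closed h_ge0 hc pdc).
  rewrite (@eq_drift _ _ (fun a => -1 * h a)) ?driftM ?h_drift ?mulr0 // => a.
  by rewrite mulN1r.
have [N N0 [z zE]] := common_denominator k.
have {}kE b : \sum_a p b a * k a = k b.
  by apply/eqP; rewrite eq_sym -subr_eq0 -drift0E kE.
have kpos := perron_pos k0 ka1 kE.
have zabs a : (`|z a|%N)%:R = N%:R * k a.
  by rewrite zE natr_absz ger0_norm // -(ler0z rat) -zE mulr_ge0.
exists (fun a => `|z a|%N) => [a|b].
  by rewrite -(ltr0n rat) zabs mulr_gt0 ?ltr0n.
under eq_bigr do rewrite zabs mulrCA.
by rewrite -mulr_sumr kE zabs.
Qed.

End Stochastic.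

(** * Indices of lattices *)

Section Lattice.
Variable A : finType.
Local Notation n := #|A|.
Implicit Types (z : {ffun A -> int}) (K : set {ffun A -> int}).

Definition rowz z : 'rV[int]_n := \row_i z (enum_val i).

Lemma rowzK z a : rowz z 0 (enum_rank a) = z a.
Proof. by rewrite mxE enum_rankK. Qed.

Definition ffunz (v : 'rV[int]_n) : {ffun A -> int} := [ffun a => v 0 (enum_rank a)].

Lemma ffunzK v : rowz (ffunz v) = v.
Proof. by apply/matrixP => i j; rewrite ord1 mxE ffunE enum_valK. Qed.

Lemma rowz_inj : injective rowz.
Proof. by move=> y z yz; apply/ffunP => a; rewrite -!rowzK yz. Qed.

Lemma rowzB y z : rowz (y - z) = rowz y - rowz z.
Proof. by apply/matrixP => i j; rewrite !mxE !ffunE. Qed.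

(** In the coordinates [w] given by the factor [R] of the Smith form, the row lattice consists of
    the vectors whose i-th entry is divisible by [c i]; residues modulo the [c i] separate the
    cosets. *)
Lemma lattice_index K (B : 'M[int]_n) : \det B != 0 ->
    (forall z, K z <-> exists u, rowz z = u *m B) ->
  subgroup_index K = `|\det B|%N.
Proof.
move=> detB KE; have [L uL [R uR [d _ BE]]] := int_Smith_normal_form B.
pose c (i : 'I_n) : int := d`_i.
have DgE : \matrix_(i, j) (d`_i *+ (i == j :> nat)) = diag_mx (\row_i c i) :> 'M[int]_n.
  by apply/matrixP => i j; rewrite !mxE.
rewrite {}DgE in BE.
have det1 (U : 'M[int]_n) : U \in unitmx -> `|\det U|%N = 1%N.
  by rewrite unitmxE unfold_in /= => /orP[]/eqP ->.
have detE : `|\det B|%N = (\prod_i `|c i|)%N.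
  rewrite BE !det_mulmx !abszM (det1 L) // (det1 R) // mul1n muln1 det_diag.
  rewrite (big_morph absz abszM absz1); apply: eq_bigr => i _; by rewrite mxE.
have c0 i : c i != 0.
  rewrite -absz_eq0 -lt0n; move: detB; rewrite -absz_eq0 detE -lt0n.
  by rewrite (bigD1 i) //= muln_gt0 => /andP[].
pose X := {dffun forall i : 'I_n, 'I_(`|c i|.-1.+1)}.
have cardX : #|[set: X]| = `|\det B|%N.
  rewrite cardsT card_dep_ffun foldrE big_map big_enum detE /=.
  by apply: eq_bigr => i _; rewrite card_ord prednK // absz_gt0.
pose w z : 'rV_n := rowz z *m invmx R.
pose f z : X := finfun (fun i : 'I_n => inord `|(w z ord0 i %% c i)%Z|%N : 'I_(`|c i|.-1.+1)).
have fE z i : (f z i : nat)%:Z = (w z ord0 i %% c i)%Z.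
  rewrite ffunE inordK; first by rewrite gez0_abs // modz_ge0.
  by rewrite prednK ?absz_gt0 // -ltz_nat gez0_abs ?modz_ge0 // ltz_mod.
rewrite -cardX; apply: (@subgroup_index_fibers _ _ _ _ f) => [z|x _|y z].
- by rewrite inE.
- exists (ffunz (\row_i (x i : nat)%:Z *m R)); apply/ffunP => i; apply/val_inj.
  apply/eqP; rewrite -eqz_nat fE /w ffunzK mulmxK // mxE -modz_abs modz_small //.
  have := ltn_ord (x i); have := c0 i; lia.
have -> : f y = f z <-> forall i, (c i %| w (y - z) ord0 i)%Z.
  have wB i : w (y - z) ord0 i = w y ord0 i - w z ord0 i by rewrite /w rowzB mulmxBl !mxE.
  split=> [fyz i|dv].
    by rewrite wB -eqz_mod_dvd; apply/eqP; rewrite -!fE fyz.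
  apply/ffunP => i; apply/val_inj/eqP; rewrite -eqz_nat !fE.
  by rewrite eqz_mod_dvd -wB.
rewrite KE; split=> [dv|[u yzE] i].
  exists (\row_i (w (y - z) ord0 i %/ c i)%Z *m invmx L).
  rewrite BE !mulmxA mulmxKV // mul_mx_diag.
  rewrite (_ : \matrix_(i, j) _ = w (y - z)); first by rewrite /w mulmxKV.
  by apply/matrixP => i j; rewrite (ord1 i) mxE [X in X * _]mxE [X in _ * X]mxE divzK ?dv.
by rewrite /w yzE BE !mulmxA mulmxK // mul_mx_diag mxE [X in _ * X]mxE dvdz_mull.
Qed.

(** [K] is generated by its elements with entries in [0, d) and by d times the unit vectors; the
    Smith form of this generating matrix [G] yields a square one. *)
Lemma lattice_basis K (d : nat) : (0 < d)%N ->
    (forall y z, K y -> K z -> K (y - z)) ->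
    (forall z, K [ffun a => z a * d%:Z]) ->
  exists2 B : 'M[int]_n, \det B != 0 & forall z, K z <-> exists u, rowz z = u *m B.
Proof.
move=> d0 Ksub Kd.
pose Kv (v : 'rV_n) := K (ffunz v).
have K0 : K 0.
  by have := Kd 0; congr K; apply/ffunP => a; rewrite !ffunE mul0r.
have Kopp y : K y -> K (- y) by rewrite -sub0r; apply: Ksub.
have Kadd y z : K y -> K z -> K (y + z).
  by move=> Ky /Kopp Kz; rewrite -[z]opprK; apply: Ksub.
have ffunzD u v : ffunz (u + v) = ffunz u + ffunz v.
  by apply/ffunP => a; rewrite !ffunE mxE.
have Kvadd u v : Kv u -> Kv v -> Kv (u + v).
  by rewrite /Kv ffunzD; apply: Kadd.
have Kv0 : Kv 0 by move: K0; congr K; apply/ffunP => a; rewrite !ffunE mxE.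
have Kvscale (c : int) v : Kv v -> Kv (c *: v).
  move=> Kvv; have Kn (k : nat) : Kv (k%:Z *: v).
    elim: k => [|k IH]; first by rewrite scale0r.
    by rewrite intS scalerDl scale1r; apply: Kvadd.
  case: c => k; first exact: Kn.
  rewrite NegzE scaleNr /Kv; have -> : ffunz (- (k.+1%:Z *: v)) = - ffunz (k.+1%:Z *: v).
    by apply/ffunP => a; rewrite !ffunE mxE.
  by apply: Kopp; apply: Kn.
have Kvmul m (u : 'rV_m) (G : 'M_(m, n)) : (forall i, Kv (row i G)) -> Kv (u *m G).
  move=> KG; rewrite mulmx_sum_row; elim/big_rec: _ => // i v _; apply: Kvadd.
  exact: Kvscale.
pose T := {ffun A -> 'I_d.-1.+1}.
pose tv (x : T) : {ffun A -> int} := [ffun a => (x a : nat)%:Z].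
pose G1 : 'M[int]_(#|T|, n) :=
  \matrix_i (if `[< K (tv (enum_val i)) >] then rowz (tv (enum_val i)) else 0).
pose G := col_mx G1 (d%:Z%:M : 'M[int]_n).
have KG i : Kv (row i G).
  rewrite -[i]splitK; case: (fintype.split i) => j /=.
    rewrite rowKu rowK; case: asboolP => // Kj; rewrite /Kv.
    by move: Kj; congr K; apply: rowz_inj; rewrite ffunzK.
  rewrite rowKd /Kv; have := Kd (ffunz (row j 1%:M)); congr K.
  by apply/ffunP => a; rewrite !ffunE !mxE mulr_natl.
have KvG v : Kv v <-> exists u, v = u *m G.
  split=> [Kvv|[u ->]]; last exact: Kvmul.
  have [z vz] : exists z, rowz z = v by exists (ffunz v); rewrite ffunzK.
  have Kz : K z by move: Kvv; congr K; apply: rowz_inj; rewrite ffunzK vz.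
  have [x xE] : exists x : T, forall a, (x a : nat)%:Z = (z a %% d)%Z.
    have dn0 : d%:Z != 0 by rewrite eqz_nat -lt0n.
    exists [ffun a => inord `|(z a %% d)%Z|%N] => a.
    rewrite ffunE inordK; first by rewrite gez0_abs // modz_ge0.
    by rewrite prednK // -ltz_nat gez0_abs ?modz_ge0 // ltz_mod.
  have zE : z = tv x + [ffun a => [ffun a => (z a %/ d)%Z] a * d%:Z].
    by apply/ffunP => a; rewrite [RHS]ffunE !ffunE xE addrC -divz_eq.
  have Kx : K (tv x).
    by have := Ksub _ _ Kz (Kd [ffun a => (z a %/ d)%Z]); rewrite {1}zE addrK.
  exists (row_mx (delta_mx 0 (enum_rank x)) (\row_i (z (enum_val i) %/ d)%Z)).
  rewrite mul_row_col -rowE rowK enum_rankK; case: asboolP => // _.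
  rewrite mul_mx_scalar; rewrite -vz; apply/matrixP => i j; rewrite (ord1 i) !mxE ffunE xE.
  by rewrite addrC mulrC -divz_eq.
have [L uL [R uR [s _ GE]]] := int_Smith_normal_form G.
(* The diagonal form of [G] vanishes below its first [n] rows, which times [R] therefore span the
   same lattice. *)
pose B := diag_mx (\row_(i < n) s`_i) *m R.
pose E : 'M[int]_(#|T| + n, n) := pid_mx n.
have DgE : \matrix_(i, j) (s`_i *+ (i == j :> nat)) = E *m diag_mx (\row_(i < n) s`_i).
  apply/matrixP => i j; rewrite mul_mx_diag !mxE.
  case: eqP => [->|_]; first by rewrite ltn_ord mul1r.
  by rewrite mul0r.
have EE : E^T *m E = 1%:M.
  by rewrite tr_pid_mx mul_pid_mx minnn (minn_idPr (leq_addl _ _)) pid_mx_1.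
have KB v : Kv v <-> exists u, v = u *m B.
  rewrite KvG GE DgE; split=> [[u ->]|[u ->]].
    by exists (u *m L *m E); rewrite /B !mulmxA.
  exists (u *m E^T *m invmx L); rewrite !mulmxA mulmxKV //.
  by rewrite -[u *m E^T *m E]mulmxA EE mulmx1 /B ?mulmxA.
exists B => [|z]; last first.
  by rewrite -KB /Kv; split; congr K; apply: rowz_inj; rewrite ffunzK.
(* The lattice contains d times each unit vector, so the scalar matrix d is a left multiple of [B];
   hence det [B] is nonzero. *)
have /choice[C CB] : forall i : 'I_n, exists u, row i (d%:Z%:M : 'M_n) = u *m B.
  by move=> i; apply/KB; have := KG (rshift #|T| i); rewrite rowKd.
have CBd : (\matrix_i C i) *m B = d%:Z%:M.
  by apply/row_matrixP => i; rewrite row_mul rowK CB.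
apply: contraTneq d0 => B0; have := congr1 determinant CBd.
rewrite det_mulmx B0 mulr0 det_scalar => /esym/eqP; rewrite expf_eq0 => /andP[_].
by rewrite eqz_nat => /eqP ->.
Qed.

(** The images under [D] of the rows of a basis [B] of [K] form an integral basis [B'] of [K'], and
    det [B'] = det [B] det [D]. *)
Lemma lattice_image_index K K' (D : 'M[rat]_n) (d : nat) : (0 < d)%N ->
    (forall y z, K y -> K z -> K (y - z)) ->
    (forall z, K [ffun a => z a * d%:Z]) ->
    0 < \det D ->
    (forall z, K z -> exists z' : {ffun A -> int},
       D *m (map_mx intr (rowz z))^T = (map_mx intr (rowz z'))^T) ->
    (forall z', K' z' <-> exists2 z, K z &
       D *m (map_mx intr (rowz z))^T = (map_mx intr (rowz z'))^T) ->
  (subgroup_index K')%:R = (subgroup_index K)%:R * \det D.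
Proof.
move=> d0 Ksub Kd detD Kint K'E.
have [B B0 KB] := lattice_basis d0 Ksub Kd.
have /choice[C CE] : forall i : 'I_n, exists z' : {ffun A -> int},
    D *m (map_mx intr (row i B))^T = (map_mx intr (rowz z'))^T.
  move=> i; rewrite -(ffunzK (row i B)); apply: Kint; apply/KB.
  by exists (delta_mx 0 i); rewrite ffunzK rowE.
pose B' : 'M[int]_n := \matrix_i rowz (C i).
have toQ m m' (U : 'M[int]_(m, n)) (W : 'M[int]_(n, m')) :
    map_mx intr (U *m W) = map_mx intr U *m map_mx intr W :> 'M[rat]__.
  by rewrite map_mxM.
have B'E : map_mx intr B' = map_mx intr B *m D^T :> 'M[rat]_n.
  apply/row_matrixP => i; rewrite row_mul -!map_row rowK.
  by apply: (can_inj (@trmxK _ _ _)); rewrite trmx_mul trmxK CE.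
have detB' : `|\det B'|%N%:R = `|\det B|%N%:R * \det D :> rat.
  rewrite !natr_absz -[X in _ = _ * X](gtr0_norm detD) !intr_norm -normrM.
  by rewrite -!det_map_mx B'E det_mulmx det_tr.
have B'0 : \det B' != 0.
  by rewrite -absz_eq0 -(eqr_nat rat) detB' mulf_neq0 ?(gt_eqF detD) // pnatr_eq0 absz_eq0.
rewrite (lattice_index B0 KB) -detB' (@lattice_index _ B') // => z'.
have image u : D *m (map_mx intr (u *m B))^T = (map_mx intr (u *m B'))^T :> 'cV[rat]_n.
  by rewrite !toQ B'E mulmxA [RHS]trmx_mul trmxK.
rewrite K'E; split=> [[z /KB[u ->]]|[u z'E]].
  rewrite image => /trmx_inj uz; exists u.
  apply/matrixP => i j; apply: (@intr_inj rat).
  by have := congr1 (fun M : 'rV_ _ => M i j) uz; rewrite /= !mxE => ->.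
exists (ffunz (u *m B)); first by apply/KB; exists u; rewrite ffunzK.
by rewrite ffunzK image z'E.
Qed.

End Lattice.

(** * Coefficients of the determinant *)

Section Coefficients.
Variables (A : finType) (R : comNzRingType).
Implicit Types (f g : fps A R) (n m : {ffun A -> nat}).

Lemma fpscoefD n f g : fpscoef (f + g) n = fpscoef f n + fpscoef g n.
Proof. by []. Qed.

Lemma fpscoefN n f : fpscoef (- f) n = - fpscoef f n.
Proof. by []. Qed.

Lemma fpscoef_sum n (I : Type) (r : seq I) (P : pred I) (F : I -> fps A R) :
  fpscoef (\sum_(i <- r | P i) F i) n = \sum_(i <- r | P i) fpscoef (F i) n.
Proof. by apply: (big_morph (fun f => fpscoef f n)). Qed.

Lemma fpscoefMn n f k : fpscoef (f *+ k) n = fpscoef f n *+ k.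
Proof. by elim: k => // k IH; rewrite !mulrS fpscoefD IH. Qed.

Lemma fpscoefM n f g :
  fpscoef (f * g) n = \sum_(i <- below n) fpscoef f i * fpscoef g (expB n i).
Proof. by []. Qed.

Definition single n a : {ffun A -> nat} := [ffun b => if b == a then n b else 0%N].

Definition univariate a f := forall m b, b != a -> m b != 0%N -> fpscoef f m = 0.

(** When the factor [a] is split off, only the exponent [single n a] contributes: any smaller one
    leaves a power of z_a that no other factor contains. *)
Lemma fpscoef_univariate_prod n (F : A -> fps A R) (s : seq A) : uniq s ->
    (forall a, univariate a (F a)) ->
  fpscoef (\prod_(a <- s) F a) n =
    if [forall b, (b \notin s) ==> (n b == 0%N)]
    then \prod_(a <- s) fpscoef (F a) (single n a) else 0.
Proof.
move=> + Fu; elim: s n => [|a s IH] n.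
  move=> _; rewrite !big_nil /=; congr (if _ then _ else _).
  apply/eqP/forallP => [-> b|n0]; first by rewrite ffunE.
  by apply/ffunP => b; rewrite ffunE; apply/eqP/n0.
rewrite cons_uniq => /andP[a_s Us]; rewrite !big_cons fpscoefM.
have na : single n a \in below n by apply/belowP => b; rewrite ffunE; case: ifP.
rewrite (bigD1_seq _ na (below_uniq n)) /= [X in _ + X]big_seq_cond [X in _ + X]big1 ?addr0.
  rewrite IH //; set b1 := [forall b, _]; set b2 := [forall b, _].
  have -> : b1 = b2.
    apply: eq_forallb => b; rewrite !ffunE inE; case: (eqVneq b a) => [->|_] /=.
      by rewrite subnn eqxx implybT.
    by rewrite subn0.
  case: b2; rewrite ?mulr0 //; congr (_ * _); apply: eq_big_seq => c cs.
  congr fpscoef; apply/ffunP => d; rewrite !ffunE; case: (eqVneq d c) => // ->.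
  by case: (eqVneq c a) cs a_s => [-> ->|_] //; rewrite subn0.
move=> i /andP[/belowP i_n i_na].
have [/existsP[b /andP[ba ib]]|] := boolP [exists b, (b != a) && (i b != 0%N)].
  by rewrite (Fu a i b) ?mul0r.
rewrite negb_exists => /forallP i0; rewrite IH // ifF ?mulr0 //.
apply/negP => /forallP/(_ a); rewrite a_s ffunE /= subn_eq0 => na_i.
case/eqP: i_na; apply/ffunP => b; rewrite ffunE; case: (eqVneq b a) => [->|ba].
  by apply/eqP; rewrite eqn_leq i_n.
by have := i0 b; rewrite ba /= negbK => /eqP.
Qed.

Lemma prod_enum_rank (T : comNzRingType) (F : 'I_#|A| -> T) :
  \prod_i F i = \prod_(a <- enum A) F (enum_rank a).
Proof.
rewrite big_enum /= [RHS](reindex _ (onW_bij _ (enum_val_bij A))) /=.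
by apply: eq_bigr => i _; rewrite enum_valK.
Qed.

(** Each Leibniz term takes one entry from every row, and distinct rows use distinct variables. *)
Lemma fpscoef_det n (B : 'M[fps A R]_#|A|) :
    (forall i j, univariate (enum_val i) (B i j)) ->
  fpscoef (\det B) n = \det (\matrix_(i, j) fpscoef (B i j) (single n (enum_val i))).
Proof.
move=> Bu; rewrite /determinant fpscoef_sum; apply: eq_bigr => s _.
rewrite !(prod_enum_rank (fun i => _)).
have signE (e : bool) f : fpscoef ((-1) ^+ e * f) n = (-1) ^+ e * fpscoef f n.
  by case: e; rewrite ?expr0 ?mul1r ?expr1 ?mulN1r.
rewrite signE; congr (_ * _); rewrite fpscoef_univariate_prod ?enum_uniq // => [|a].
  rewrite ifT; last by apply/forallP => b; rewrite mem_enum.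
  by apply: eq_bigr => a _; rewrite mxE enum_rankK.
by rewrite -{1}[a]enum_rankK; apply: Bu.
Qed.

End Coefficients.

(** Powers of z_a in 1/(1 - z_a) all have coefficient 1, while the constants of P survive in row a
    only if [n a] is 0. *)
Lemma fpscoef_det_geometric (A : finType) (P : 'M[rat]_#|A|) (n : {ffun A -> nat}) :
  fpscoef (\det (diag_mx (\row_(i < #|A|) (1 - 'z_(enum_val i))^-1)
            - map_mx (fps_const A (R := rat)) P)) n =
  \det (drift_mx (fun b a => P (enum_rank b) (enum_rank a)) (fun a => 0 < n a)%N).
Proof.
have geomE a := (fps_geomE rat a).2.
rewrite fpscoef_det => [|i j m b ba mb].
  congr (\det _); apply/matrixP => i j; rewrite !mxE fpscoefD fpscoefN fpscoefMn.
  rewrite geomE /= /killed !enum_valK ifT; last first.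
    by apply/forallP => b; apply/implyP => /negPf ba; rewrite ffunE ba.
  congr (_ - _).
  case: posnP => na; [rewrite ifT // | rewrite ifF //].
    apply/eqP/ffunP => b; rewrite !ffunE; case: eqP => // ->.
    by rewrite na.
  apply/negP => /eqP/ffunP/(_ (enum_val i)); rewrite !ffunE eqxx => n0.
  by rewrite n0 in na.
rewrite !mxE fpscoefD fpscoefN fpscoefMn geomE /= ifF.
  rewrite ifF ?mul0rn ?subr0 //.
  by apply/negP => /eqP m0; rewrite m0 ffunE in mb.
by apply/negP => /forallP/(_ b); rewrite ba (negPf mb).
Qed.

(** * Networks with only locally recurrent states *)

Section TransitiveNetwork.
Variables (A Q : finType) (t : A -> Q -> Q) (M : A -> Q -> A -> nat).
Hypothesis tC : forall a b q, t a (t b q) = t b (t a q).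
Hypothesis MC : forall a b q c,
  (M a q c + M b (t a q) c = M b q c + M a (t b q) c)%N.
Hypothesis M_sum : forall a q, (\sum_b M a q b = 1)%N.
Hypothesis t_conn : forall q q', exists w, actw t w q = q'.
Variable K : set {ffun A -> int}.
Hypothesis K_act : forall q w w',
  K [ffun a => (cnt w a)%:Z - (cnt w' a)%:Z] <-> actw t w q = actw t w' q.
Variable p : A -> A -> rat.
Hypothesis p_ge0 : forall b a, 0 <= p b a.
Hypothesis p_sum : forall a, \sum_b p b a = 1.
Hypothesis p_conn : forall a b, connect (fun a b => 0 < p b a) a b.
Hypothesis p_out : forall q w b, actw t w q = q ->
  (outw t M w q b)%:R = \sum_a p b a * (cnt w a)%:R :> rat.
Variables (q0 : Q) (n : A -> nat) (s0 : A).
Hypothesis ns0 : (0 < n s0)%N.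

Local Notation act := (actw t).
Local Notation out := (outw t M).
Let S : pred A := fun a => (0 < n a)%N.
Let S_s0 : S s0 := ns0.
Let d := (#|Q|)`!.
Let d_gt0 : (0 < d)%N := fact_gt0 _.

(** By [iter_fact] the state [iter d (t a) q] is fixed by [iter d (t a)]; a word carrying it to [q]
    commutes with [t a]. *)
Lemma iter_period a q : iter d (t a) q = q.
Proof.
have [w wq] := t_conn (iter d (t a) q) q.
have E : iter (d + d) (t a) q = iter d (t a) q by apply: iter_fact.
have := congr1 (act w) E; rewrite wq iterD.
by move: wq; rewrite -!act_nseq => wq; rewrite (actC tC w) wq.
Qed.

Lemma act_period w q : (forall a, d %| cnt w a)%N -> act w q = q.
Proof. by apply: act_dvd => // a; apply: iter_period. Qed.

(** One word [u] closes up both words at [q], and its contribution cancels. *)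
Lemma out_diff q w w' b : act w q = act w' q ->
  (out w q b)%:R - (out w' q b)%:R =
    \sum_a p b a * ((cnt w a)%:R - (cnt w' a)%:R) :> rat.
Proof.
move=> ww'; have [u uq] := t_conn (act w q) q.
have uw : act (w ++ u) q = q by rewrite act_cat.
have uw' : act (w' ++ u) q = q by rewrite act_cat -ww'.
have := p_out b uw; have := p_out b uw'; rewrite !out_cat -ww' !natrD => E' E.
have -> : (out w q b)%:R - (out w' q b)%:R =
   (out w q b)%:R + (out u (act w q) b)%:R -
   ((out w' q b)%:R + (out u (act w q) b)%:R) :> rat by ring.
rewrite E E' -sumrB; apply: eq_bigr => a _; rewrite !cnt_cat !natrD; ring.
Qed.

(* Discarding the letters sent to the support S of n gives a halting network,
   whose stabilization maps [psi z] form a commutative monoid. *)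
Let M' a q b := if S b then 0%N else M a q b.
Local Notation out' := (outw t M').

Let MC' a b q c : (M' a q c + M' b (t a q) c = M' b q c + M' a (t b q) c)%N.
Proof. by rewrite /M'; case: ifP. Qed.

Lemma out_killedE w q b : out' w q b = if S b then 0%N else out w q b.
Proof. by elim: w q => [|a w IH] q /=; rewrite /M' ?IH; case: ifP. Qed.

Lemma drift_cnt q w w' b : act w q = act w' q ->
  drift p S (fun a => (cnt w a)%:R - (cnt w' a)%:R) b =
  (cnt w b)%:R - (out' w q b)%:R - ((cnt w' b)%:R - (out' w' q b)%:R).
Proof.
move=> ww'; have := out_diff b ww'; rewrite !out_killedE /drift /killed.
case: (S b) => [_|<-]; last by ring.
by rewrite big1 => [|a _]; rewrite ?mul0r //; ring.
Qed.

Lemma drift_cnt1 q w b : act w q = q ->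
  drift p S (fun a => (cnt w a)%:R) b = (cnt w b)%:R - (out' w q b)%:R.
Proof.
move=> wq; have := @drift_cnt q w [::] b wq; rewrite /= !subr0 => <-.
by apply: eq_drift => a; rewrite subr0.
Qed.

(** In the scaling of [g] by [N * d], the factor [d] makes the word act trivially, so that its net
    removal of letters is its drift, and [N] makes this large. *)
Lemma absorbing_word N : exists w, (forall q, act w q = q) /\
  forall q b, (N + out' w q b <= cnt w b)%N.
Proof.
have [g gE] := drift_pos p_ge0 p_sum p_conn S_s0.
pose w := word (fun a => N * d * g a)%N.
have w1 q : act w q = q.
  by apply: act_period => a; rewrite cnt_word mulnAC dvdn_mull.
exists w; split=> // q b; rewrite -(ler_nat rat) natrD -lerBrDr.
rewrite -drift_cnt1 // (@eq_drift _ _ _ _ (fun a => (N * d)%:R * (g a)%:R)) => [|a].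
  rewrite driftM; apply: le_trans (_ : (N * d)%:R <= _).
    by rewrite ler_nat leq_pmulr.
  by rewrite ler_peMr.
by rewrite cnt_word natrM.
Qed.

Let halting z q : exists m, forall b, (z b + out' m q b <= cnt m b)%N.
Proof.
have [m [_ mE]] := absorbing_word (\sum_b z b)%N; exists m => b.
by apply: leq_trans (mE q b); rewrite leq_add2r (bigD1 b) //= leq_addr.
Qed.

Local Notation psi := (stab tC MC' halting).
Local Notation odo := (odometer tC MC' halting).
Local Notation R := (stable_image psi).

Let psi_eq y z q : y =1 z -> psi y q = psi z q. Proof. exact: stab_eq. Qed.
Let psiD z x y q : (forall b, z b = x b + y b)%N -> psi z q = psi y (psi x q).
Proof. exact: stabD. Qed.
Let psi0 z q : z =1 (fun=> 0%N) -> psi z q = q. Proof. exact: stab0. Qed.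

(** The lattice (1 - P')K. *)
Definition drift_lattice : set {ffun A -> int} := [set z | exists2 k, K k &
  forall b, drift p S (fun a => (k a)%:~R) b = (z b)%:~R]%classic.
Local Notation L := drift_lattice.

(** Adding [d] times the absolute value of [k] makes the counts nonnegative; [w2] is trivial by
    periodicity, and [w1] because it differs from [w2] by an element of [K]. *)
Lemma kernel_words k : K k -> exists w1 w2, [/\ forall q, act w1 q = q,
  forall q, act w2 q = q & forall a, k a = (cnt w1 a)%:Z - (cnt w2 a)%:Z].
Proof.
move=> Kk; pose w2 := word (fun a => d * `|k a|)%N.
have w2q q : act w2 q = q by apply: act_period => a; rewrite cnt_word dvdn_mulr.
pose w1 := word (fun a => absz (k a + (d * absz (k a))%N%:Z)).
have kE a : k a = (cnt w1 a)%:Z - (cnt w2 a)%:Z.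
  rewrite !cnt_word gez0_abs; first by rewrite addrK.
  have : (1 * absz (k a) <= d * absz (k a))%N by rewrite leq_mul2r d_gt0 orbT.
  by lia.
exists w1, w2; split=> // q; rewrite -[RHS](w2q q); apply/K_act.
by move: Kk; congr K; apply/ffunP => a; rewrite ffunE kE.
Qed.

Lemma kernel_sub y z : K y -> K z -> K (y - z).
Proof.
move=> /kernel_words[v1 [v2 [v1q v2q yE]]] /kernel_words[w1 [w2 [w1q w2q zE]]].
have -> : y - z = [ffun a => (cnt (v1 ++ w2) a)%:Z - (cnt (v2 ++ w1) a)%:Z].
  by apply/ffunP => a; rewrite !ffunE yE zE !cnt_cat; lia.
by apply/(K_act q0); rewrite !act_cat v1q v2q w1q w2q.
Qed.

Lemma kernel_period z : K [ffun a => z a * d%:Z].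
Proof.
have -> : [ffun a => z a * d%:Z] =
    [ffun a => (cnt (word (fun a => d * `|Num.max (z a) 0|)%N) a)%:Z
             - (cnt (word (fun a => d * `|Num.max (- z a) 0|)%N) a)%:Z].
  by apply/ffunP => a; rewrite !ffunE !cnt_word; lia.
by apply/(K_act q0); rewrite !act_period // => a; rewrite cnt_word dvdn_mulr.
Qed.

Lemma drift_words k w1 w2 q b :
    (forall a, k a = (cnt w1 a)%:Z - (cnt w2 a)%:Z) ->
    act w1 q = q -> act w2 q = q ->
  drift p S (fun a => (k a)%:~R) b =
    ((cnt w1 b)%:Z - (out' w1 q b)%:Z - ((cnt w2 b)%:Z - (out' w2 q b)%:Z))%:~R.
Proof.
move=> kE w1q w2q.
rewrite (@eq_drift _ _ _ _ (fun a => (cnt w1 a)%:R - (cnt w2 a)%:R)) => [|a].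
  by rewrite (@drift_cnt q) ?w1q ?w2q // !intrB.
by rewrite kE intrB.
Qed.

(** If the results agree, the odometers act alike on [q], so their difference lies in [K], with
    drift [y - z]. Conversely, firing [w1] or [w2] from a large [x] fixing [q] leaves two inputs
    that fix [q] and differ by [z - y]. *)
Lemma stab_drift_lattice y z q : q \in R -> psi y q = psi z q <->
  L [ffun b => (y b)%:Z - (z b)%:Z].
Proof.
move=> qR; split=> [yz|[k Kk kE]].
  exists [ffun a => (cnt (odo y q) a)%:Z - (cnt (odo z q) a)%:Z].
    exact/(K_act q).
  move=> b; rewrite (@eq_drift _ _ _ _
    (fun a => (cnt (odo y q) a)%:R - (cnt (odo z q) a)%:R)) => [|a].
    rewrite (drift_cnt b yz) !odometerE ffunE intrB !natrD; ring.
  by rewrite ffunE intrB.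
have [w1 [w2 [w1q w2q kw]]] := kernel_words Kk.
(* A constant multiple of [d], so that [x] fixes [q], large enough to fire [w1] or [w2] legally. *)
pose x := (fun=> ((\sum_b (cnt w1 b + cnt w2 b)) * d)%N) : A -> nat.
have xE b : (cnt w1 b + cnt w2 b <= x b)%N.
  by rewrite /x -[X in (X <= _)%N]muln1 leq_mul // (bigD1 b) //= leq_addr.
have xq : psi x q = q by apply: stable_image_fix.
pose x' w b := (x b + out' w q b - cnt w b)%N.
have fire w : act w q = q -> (forall b, cnt w b <= x b)%N -> psi (x' w) q = q.
  move=> wq wx; rewrite -[RHS]xq (@stab_fire_le _ _ _ _ tC MC' halting x (x' w) q w) ?wq //.
  by move=> b; rewrite /x'; have := wx b; lia.
have f1 : psi (x' w1) q = q by apply: fire => // b; have := xE b; lia.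
have f2 : psi (x' w2) q = q by apply: fire => // b; have := xE b; lia.
rewrite -[in LHS]f1 -[in RHS]f2.
rewrite -(@psiD (fun b => x' w1 b + y b)%N) // -(@psiD (fun b => x' w2 b + z b)%N) //.
apply: psi_eq => b; have := kE b; rewrite (drift_words b kw (w1q q) (w2q q)) ffunE.
by move/intr_inj; rewrite /x'; have := xE b; lia.
Qed.

(** Given exactly the letters of [w] as input at [q], firing them leads to [q'] with [out' w q]
    pending. *)
Lemma stab_conn q q' : exists y z, psi y q = psi z q'.
Proof.
have [w <-] := t_conn q q'; exists (cnt w), (out' w q).
by apply: stab_fire_le => // b; rewrite addnC.
Qed.

Lemma drift_lattice_sub y z : L y -> L z -> L (y - z).
Proof.
move=> [k Kk kE] [l Kl lE]; exists (k - l); first exact: kernel_sub.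
move=> b; rewrite (@eq_drift _ _ _ _ (fun a => (k a)%:~R - (l a)%:~R)) => [|a].
  by rewrite driftB kE lE !ffunE intrB.
by rewrite !ffunE intrB.
Qed.

Lemma card_stable_image :
  (subgroup_index K)%:R * \det (drift_mx p S) = #|R|%:R.
Proof.
rewrite -(torsor_index psi_eq psiD psi0 drift_lattice_sub stab_drift_lattice stab_conn q0).
have DE k i : (drift_mx p S *m (map_mx intr (rowz k))^T) i 0 =
    drift p S (fun a => (k a)%:~R) (enum_val i).
  rewrite -drift_mxE; congr ((_ *m _) i 0).
  by apply/matrixP => j l; rewrite !mxE.
have imE k z : drift_mx p S *m (map_mx intr (rowz k))^T = (map_mx intr (rowz z))^T <->
    forall b, drift p S (fun a => (k a)%:~R) b = (z b)%:~R.
  split=> [E b|E]; last first.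
    by apply/matrixP => i j; rewrite (ord1 j) DE E !mxE.
  by rewrite -[b]enum_rankK -DE E !mxE.
rewrite (@lattice_image_index _ K L (drift_mx p S) d) //.
- exact: kernel_sub.
- exact: kernel_period.
- by rewrite lt_neqAle eq_sym (det_drift_neq0 p_ge0 p_sum p_conn S_s0) det_drift_ge0.
- move=> k /kernel_words[w1 [w2 [w1q w2q kE]]].
  exists [ffun b => (cnt w1 b)%:Z - (out' w1 q0 b)%:Z - ((cnt w2 b)%:Z - (out' w2 q0 b)%:Z)].
  by apply/imE => b; rewrite (drift_words b kE (w1q q0) (w2q q0)) ffunE.
- by move=> z; split=> [[k Kk kE]|[k Kk kE]]; exists k => //; apply/imE.
Qed.

(* The burning test: for locally recurrent q, such a cycle exists if and only
   if n.q is recurrent. *)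
Definition full_cycle q w := [/\ legal_after t M n q [::] w, act w q = q,
  forall b, cnt w b = out w q b & forall b, (0 < cnt w b)%N].

(** On [S] the input [k] supplies all letters in advance; off [S] there is no initial input and
    nothing is killed, so the conditions coincide. *)
Lemma legal_killed k q m w : (forall b, cnt (m ++ w) b <= k b)%N ->
    legal_after t M n q m w ->
  legal_after t M' (fun b => if S b then k b else 0%N) q m w.
Proof.
elim: w m => //= a w IH m le_k /andP[am lw].
rewrite IH ?cat_rcons // andbT out_killedE.
move: (le_k a) am; rewrite cnt_cat cnt_cons eqxx /S.
by case: (posnP (n a)) => [->|_] /=; lia.
Qed.

(** From input [z] the killed network fires exactly [w]. Among [r] repetitions, an absorbing word
    [u] is postponed to the end; before it the state is [q] and at least [d] of each letter are
    pending. *)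
Lemma full_cycle_stable q w : full_cycle q w -> q \in R.
Proof.
case=> lw wq wE w0; pose z b := if S b then cnt w b else 0%N.
have zw b : (cnt w b = z b + out' w q b)%N.
  by rewrite /z out_killedE -wE; case: ifP; rewrite ?addn0.
have lz : legal_after t M' z q [::] w by apply: legal_killed lw.
have [u [u1 uE]] := absorbing_word d.
pose r := (\sum_b cnt u b)%N; pose wr := flatten (nseq r w).
have wrq : act wr q = q by apply: act_flatten_nseq.
have wrE b : (cnt wr b = r * z b + out' wr q b)%N.
  by rewrite cnt_flatten_nseq out_flatten_nseq // -mulnDr -zw.
have lwr : legal_after t M' (fun b => r * z b)%N q [::] wr.
  rewrite /wr; elim: (r) => //= k IH.
  apply: (legal_after_trans (x := fun b => k * z b)%N); rewrite ?wq //.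
    by move=> b; rewrite zw; lia.
  by apply: legal_after_le lz => b; rewrite mulSn leq_addr.
have ur b : (cnt u b <= cnt wr b)%N.
  rewrite cnt_flatten_nseq (leq_trans _ (leq_pmulr r (w0 b))) //.
  by rewrite /r (bigD1 b) //= leq_addr.
pose v := word (fun b => cnt wr b - cnt u b)%N.
have vu b : cnt wr b = cnt (v ++ u) b by rewrite cnt_cat cnt_word subnK.
have vq : act v q = q.
  by rewrite -[RHS]wrq (act_count tC _ vu) act_cat u1.
pose x b := (cnt u b - out' u q b)%N.
have -> : q = psi x q.
  transitivity (psi (fun b => r * z b)%N q).
    by rewrite (stab_uniq tC MC' halting lwr).
  rewrite (@stab_fire _ _ _ _ tC MC' halting _ x q v) ?vq // => b.
    by rewrite (odometer_uniq tC MC' halting lwr) // cnt_word leq_subr.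
  have := wrE b; rewrite (out_count tC MC' _ _ vu) out_cat vq.
  by have := uE q b; have := ur b; rewrite /x /v cnt_word; lia.
by apply: stable_imageP => // b; have := uE q b; rewrite /x; lia.
Qed.

Lemma sum_out w q : (\sum_b out w q b = \sum_b cnt w b)%N.
Proof.
elim: w q => [|a w IH] q /=; first by rewrite !big1.
rewrite big_split /= M_sum IH; under [RHS]eq_bigr do rewrite cnt_cons.
rewrite big_split /=; congr addn; rewrite (bigD1 a) //= eqxx big1 // => b /negPf.
by rewrite eq_sym => ->.
Qed.

(** A longest legal word [w] below the Perron vector [k] is shown to reach [k] by comparison with
    the killed odometer of [z], the restriction of [k] to [S]. *)
Lemma stable_full_cycle q : q \in R -> exists w, full_cycle q w.
Proof.
move=> qR; have [k1 k1_gt0 k1E] := perron p_ge0 p_sum p_conn s0.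
pose k b := (d * k1 b)%N.
have k_gt0 b : (0 < k b)%N by rewrite muln_gt0 d_gt0 k1_gt0.
pose kw := word k.
have kwq r : act kw r = r.
  by apply: act_period => a; rewrite cnt_word dvdn_mulr.
have out_kw r b : out kw r b = k b.
  apply/eqP; rewrite -(eqr_nat rat) (p_out b (kwq r)).
  under eq_bigr do rewrite cnt_word natrM mulrCA.
  by rewrite -mulr_sumr k1E natrM.
pose z b := if S b then k b else 0%N.
have zE b : (k b = z b + out' kw q b)%N.
  by rewrite out_killedE out_kw /z; case: ifP; rewrite ?addn0.
(* [z] equals (1 - P')k, so it acts on [q] as 0 does. *)
have psi_z : psi z q = q.
  rewrite -[RHS](psi0 (z := fun=> 0%N)) //; apply/(stab_drift_lattice _ _ qR).
  exists [ffun b => (k b)%:Z].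
    have -> : [ffun b => (k b)%:Z] = [ffun b => (cnt kw b)%:Z - (cnt [::] b)%:Z].
      by apply/ffunP => b; rewrite !ffunE cnt_word subr0.
    by apply/(K_act q); rewrite kwq.
  move=> b; rewrite (@eq_drift _ _ _ _ (fun a => (cnt kw a)%:R)) => [|a].
    by rewrite (drift_cnt1 b (kwq q)) cnt_word ffunE subr0 zE natrD addrK.
  by rewrite ffunE cnt_word.
pose W := odo z q.
(* [W] and [kw] are closed at [q] with the same drift [z], and 1 - P' is injective. *)
have Wk b : cnt W b = k b.
  apply/eqP; rewrite -(eqr_nat rat) -[in X in _ == X](cnt_word k b); apply/eqP.
  apply: (drift_inj p_ge0 p_sum p_conn S_s0 (h := fun b => (cnt W b)%:R)
    (k := fun b => (cnt kw b)%:R)) => c.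
  rewrite (drift_cnt1 c psi_z) (drift_cnt1 c (kwq q)) odometerE cnt_word zE.
  by rewrite !natrD !addrK.
have [w [lw wk wmax]] : exists w, [/\ legal_after t M n q [::] w,
    forall b, (cnt w b <= k b)%N &
    forall b, (cnt w b < k b)%N -> (n b + out w q b <= cnt w b)%N].
  pose P l := [exists w : l.-tuple A,
    legal_after t M n q [::] w && [forall b, cnt w b <= k b]%N].
  have size_le w : (forall b, cnt w b <= k b)%N -> (size w <= size kw)%N.
    move=> wk; have -> : size kw = size (w ++ word (fun a => k a - cnt w a)%N).
      by apply/perm_size/perm_count => a; rewrite cnt_cat !cnt_word subnKC.
    by rewrite size_cat leq_addr.
  have bound l : P l -> (l <= size kw)%N.
    case/existsP => w /andP[_ /forallP wk].
    by rewrite -[l in (l <= _)%N](size_tuple w) size_le.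
  have P0 : exists l, P l.
    by exists 0%N; apply/existsP; exists [tuple]; apply/forallP.
  have [l /existsP[w /andP[lw /forallP wk]] maxl] := ex_maxnP P0 bound.
  exists w; split=> // b bk; rewrite leqNgt; apply/negP => wb.
  suff /maxl : P l.+1 by rewrite ltnn.
  apply/existsP; exists [tuple of rcons w b]; rewrite /= legal_after_rcons lw wb /=.
  apply/forallP => c; rewrite cnt_rcons; have := wk c.
  by case: eqVneq => [<-|_]; lia.
(* The unfired rest of [k]. Where [w] stops short nothing is pending, so [u] emits at least what it
   fires; conservation of agents forces equality. *)
pose u := word (fun b => k b - cnt w b)%N.
have uw b : cnt (w ++ u) b = cnt kw b by rewrite cnt_cat !cnt_word subnKC.
have outE b : (out w q b + out u (act w q) b = k b)%N.
  by rewrite -out_cat (out_count tC MC _ _ uw) out_kw.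
have u_le b : (cnt u b <= out u (act w q) b ?= iff
    (cnt u b == out u (act w q) b))%N.
  apply/leqif_eq; rewrite cnt_word.
  have := outE b; have := wmax b; have := wk b; lia.
have u_eq b : cnt u b = out u (act w q) b.
  have := leqif_sum (P := xpredT) (fun b _ => u_le b).
  by rewrite sum_out => -[_]; rewrite eqxx => /esym/forallP/(_ b)/eqP.
(* Where [w] stops short, the equality gives [n b = 0], so [b] is outside [S]; hence [w] stabilizes
   [z] in the killed network. *)
have kw_le b : (k b <= cnt w b)%N.
  rewrite -Wk; apply: (least_action tC MC' (x := z) (q := q) (p := [::])) b => //.
    move=> b; have [wb|] := ltnP (cnt w b) (k b).
      have nb : n b = 0%N.
        by have := u_eq b; have := outE b; have := wmax b wb; rewrite cnt_word; lia.
      have := wmax b wb; rewrite /z out_killedE /S nb /=; lia.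
    move=> kb; apply: leq_trans kb; rewrite -Wk odometerE leq_add2l.
    by apply: out_le => // c; rewrite Wk.
  exact: odometer_legal.
have wE b : cnt w b = cnt kw b.
  by apply/eqP; rewrite eqn_leq cnt_word wk kw_le.
exists w; split=> // [|b|b].
- by rewrite (act_count tC _ wE).
- by rewrite (out_count tC MC _ _ wE) out_kw wE cnt_word.
- by rewrite wE cnt_word.
Qed.

Lemma card_full_cycle :
  (subgroup_index K)%:R * \det (drift_mx p S) =
  #|[set q : Q | `[< exists w, full_cycle q w >]]|%:R.
Proof.
rewrite card_stable_image; congr _%:R; apply: eq_card => q; rewrite inE.
by apply/idP/asboolP => [/stable_full_cycle|[w /full_cycle_stable]].
Qed.

End TransitiveNetwork.

(** * Agent networks *)

Section Bridge.
Variables (V : finType) (edge : V -> V -> finType) (N : network edge).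
Local Notation letter := (letter N).
Local Notation gstate := (gstate N).
Implicit Types (a b : letter) (w : seq letter) (q : gstate).

Lemma step_neq a q v : tag a != v -> step a q v = q v.
Proof. by move=> av; rewrite ffunE dfwith_out. Qed.

Lemma step_eq v (a : alphabet N v) q :
  step (Tagged (alphabet N) a) q v = trans a (q v).
Proof. by rewrite ffunE dfwith_in. Qed.

Lemma stepC a b q : step a (step b q) = step b (step a q).
Proof.
apply/ffunP => v; case: a b => [va a] [vb b].
have [Ea|na] := eqVneq va v; have [Eb|nb] := eqVneq vb v; subst.
- by rewrite !step_eq transC.
- by rewrite step_eq !(@step_neq (existT _ vb b)) // step_eq.
- by rewrite step_eq !(@step_neq (existT _ va a)) // step_eq.
- by rewrite !step_neq.
Qed.

Lemma emitE v (a : alphabet N v) q c : emit (Tagged (alphabet N) a) q c =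
  (\sum_(e : edge v (tag c)) count_mem (tagged c) (msg e (q v) a))%N.
Proof. by rewrite ffunE. Qed.

Lemma emitC a b q c :
  (emit a q c + emit b (step a q) c = emit b q c + emit a (step b q) c)%N.
Proof.
case: a b => [va a] [vb b]; rewrite !emitE.
have [E|ne] := eqVneq va vb; last first.
  by rewrite !step_neq ?[vb == _]eq_sym //= addnC.
subst; rewrite !step_eq -!big_split /=; apply: eq_bigr => e _.
by rewrite -!count_cat; apply/permP/msgC.
Qed.

Local Notation act := (actw (@step _ _ N)).
Local Notation out := (outw (@step _ _ N) (fun a q => emit a q)).

Lemma stepwE w q : stepw w q = act w q. Proof. by elim: w q => /=. Qed.

Lemma emitwE w q b : emitw w q b = out w q b.
Proof. by elim: w q => [|a w IH] q /=; rewrite ffunE ?IH. Qed.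

(** * Locally recurrent states and the production matrix *)

Let d := (#|gstate|)`!.
Let d_gt0 : (0 < d)%N := fact_gt0 _.

(** [idem_prod] is the action of a word [w] whose [d]-th power fixes [q], so [q] is its image of the
    state reached by the power [d.-1]. *)
Lemma Loc_of_periodic q : (forall a, iter d (step a) q = q) -> q \in Loc N.
Proof.
move=> qd; have : idem_prod N \in step_monoid N.
  rewrite /idem_prod; elim/big_ind: _ => [|f g|f /andP[]//].
    by rewrite inE; apply/asboolP; exists [::] => r; rewrite ffunE.
  rewrite !inE => -[w wE] [w' w'E]; exists (w' ++ w) => r.
  by rewrite ffunE w'E wE !stepwE act_cat.
rewrite inE => /asboolP[w wE]; apply/imsetP.
exists (act (flatten (nseq d.-1 w)) q); rewrite ?inE //.
rewrite wE stepwE -act_cat (_ : _ ++ w = flatten (nseq d.-1 w ++ [:: w])).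
  symmetry; apply: (act_dvd stepC qd) => a.
  by rewrite flatten_cat cnt_cat cnt_flatten_nseq /= cats0 addnC -mulSn prednK // dvdn_mulr.
by rewrite flatten_cat /= cats0.
Qed.

(** [iter d (step a)] is an idempotent of the monoid, hence a factor of [idem_prod]; by
    commutativity it moves next to that factor and is absorbed. *)
Lemma Loc_periodic q a : q \in Loc N -> iter d (step a) q = q.
Proof.
case/imsetP => r _ ->.
have [f fE] : exists f : {ffun gstate -> gstate}, forall x, f x = iter d (step a) x.
  by exists [ffun q => iter d (step a) q] => x; rewrite ffunE.
have f_mon : f \in step_monoid N.
  by rewrite inE; apply/asboolP; exists (nseq d a) => x; rewrite fE stepwE act_nseq.
have f_idem : end_comp f f == f.
  by apply/eqP/ffunP => x; rewrite ffunE !fE -iterD iter_fact.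
have monC g : g \in step_monoid N -> forall x, f (g x) = g (f x).
  rewrite inE => /asboolP[w wE] x; rewrite !wE !fE !stepwE -!act_nseq.
  exact: (actC stepC).
pose P g := (g \in step_monoid N) && (end_comp g g == g).
suff H s x : f \in s ->
    f ((\big[@end_comp _ _ N/end_id N]_(g <- s | P g) g) x) =
    (\big[@end_comp _ _ N/end_id N]_(g <- s | P g) g) x.
  by rewrite -fE /idem_prod H // mem_index_enum.
elim: s x => // g s IH x; rewrite inE big_cons; have [<-|fg] /= := eqVneq f g.
  by rewrite /P f_mon f_idem ffunE !fE -iterD iter_fact.
move=> fs; case: ifP => [/andP[g_mon _]|_]; last exact: IH.
by rewrite ffunE monC // IH.
Qed.

Lemma Loc_nonempty : exists q, q \in Loc N.
Proof.
have q : gstate by apply/finfun => v; have /card_gt0P/sigW[q _] := state_gt0 N v.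
by exists (idem_prod N q); apply/imsetP; exists q.
Qed.

Lemma act_dvd_Loc w q : q \in Loc N -> (forall a, d %| cnt w a)%N -> act w q = q.
Proof. by move=> qL; apply: (act_dvd stepC) => a; apply: Loc_periodic. Qed.

Lemma act_Loc w q : q \in Loc N -> act w q \in Loc N.
Proof.
move=> qL; apply: Loc_of_periodic => a.
by rewrite -act_nseq (actC stepC) act_nseq Loc_periodic.
Qed.

Hypothesis N_irr : locally_irreducible N.

(** The power [d.-1] of [w'] undoes [w'] at the locally recurrent [q']. *)
Lemma Loc_conn q q' : q' \in Loc N -> exists w, act w q = q'.
Proof.
move=> q'L; have [w [w']] := N_irr q q'; rewrite !stepwE => ww'.
exists (w ++ flatten (nseq d.-1 w')); rewrite act_cat ww' -act_cat.
rewrite (act_dvd_Loc q'L) // => a.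
by rewrite cnt_cat cnt_flatten_nseq -mulSn prednK // dvdn_mulr.
Qed.

(** One state suffices to test the kernel: words commute, and every state of [Loc N] is reached from
    [act c q], where [c] is the common part of [w] and [w']. *)
Lemma kernelP q w w' : q \in Loc N ->
  total_kernel N [ffun a => (cnt w a)%:Z - (cnt w' a)%:Z] <-> act w q = act w' q.
Proof.
move=> qL; set z := [ffun a => _].
pose c := word (fun a => minn (cnt w a) (cnt w' a)).
have wE a : cnt w a = cnt (c ++ word (pos_part z)) a.
  by rewrite cnt_cat !cnt_word !ffunE; lia.
have w'E a : cnt w' a = cnt (c ++ word (neg_part z)) a.
  by rewrite cnt_cat !cnt_word !ffunE; lia.
rewrite (act_count stepC _ wE) (act_count stepC _ w'E) !act_cat.
split=> [Kz|Ez r rL].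
  by have := Kz _ (act_Loc c qL); rewrite /stepn !stepwE.
have [v <-] := Loc_conn (act c q) rL.
by rewrite /stepn !stepwE !(actC stepC _ v) Ez.
Qed.

Lemma kernel_closed w q : q \in Loc N -> total_kernel N (intvec [ffun a => cnt w a]) ->
  act w q = q.
Proof.
move=> qL Kw; apply/(kernelP w [::] qL); move: Kw; congr (total_kernel N).
by apply/ffunP => a; rewrite !ffunE subr0.
Qed.

(** A word [u] from [q] to [q'] may be fired before or after [w] with the same total output. *)
Lemma closed_out w q q' b : q' \in Loc N ->
  act w q = q -> act w q' = q' /\ out w q' b = out w q b.
Proof.
move=> q'L wq; have [u <-] := Loc_conn q q'L; split; first by rewrite (actC stepC) wq.
apply: (@addnI (out u q b)); rewrite -out_cat.
rewrite (@out_count _ _ _ _ stepC emitC _ (w ++ u)) => [|a].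
  by rewrite out_cat wq addnC.
by rewrite !cnt_cat addnC.
Qed.

Lemma out_flatten (s : seq (seq letter)) q b : (forall w, w \in s -> act w q = q) ->
  out (flatten s) q b = (\sum_(w <- s) out w q b)%N.
Proof.
elim: s => [|w s IH] sq; first by rewrite big_nil.
rewrite /= out_cat big_cons sq ?mem_head // IH // => v vs.
by rewrite sq // inE vs orbT.
Qed.

(** Column [a] is the output of the closed word [nseq d a], divided by [d]. *)
Lemma production_matrix_exists : exists P : 'M[rat]_#|letter|, is_production_matrix P.
Proof.
have [q0 q0L] := Loc_nonempty.
exists (\matrix_(i, j) ((out (nseq d (enum_val j)) q0 (enum_val i))%:R / d%:R)).
move=> k Kk q qL; apply/matrixP => i j; rewrite !mxE.
set b := enum_val i.
have kwq r : r \in Loc N -> act (word k) r = r.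
  move=> rL; apply: kernel_closed => //; move: Kk; congr (total_kernel N (intvec _)).
  by apply/ffunP => a; rewrite ffunE cnt_word.
have dn0 : d%:R != 0 :> rat by rewrite pnatr_eq0 -lt0n.
pose s := [seq flatten (nseq (k a) (nseq d a)) | a <- enum letter].
have nseq_q a : act (nseq d a) q0 = q0.
  by rewrite act_nseq Loc_periodic.
(* [d] copies of [word k] and [k a] copies of each [nseq d a] have equal counts. *)
have E : (d * out (word k) q0 b = \sum_a k a * out (nseq d a) q0 b)%N.
  rewrite -(out_flatten_nseq _ _ _ (kwq q0 q0L)).
  rewrite (@out_count _ _ _ _ stepC emitC _ (flatten s)) => [|a].
    rewrite out_flatten => [|w /mapP[a _ ->]]; last exact: act_flatten_nseq.
    by rewrite /s big_map enumT; apply: eq_bigr => a _; rewrite out_flatten_nseq.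
  rewrite cnt_flatten_nseq cnt_word /cnt /s count_flatten sumnE !big_map -enumT.
  rewrite big_enum /= (bigD1 a) //= big1 ?addn0 => [|c /negPf ca].
    by rewrite -/(cnt _ a) cnt_flatten_nseq cnt_nseq eqxx mul1n mulnC.
  by rewrite -/(cnt _ a) cnt_flatten_nseq cnt_nseq ca muln0.
have -> : emitn k q b = out (word k) q0 b.
  by rewrite /emitn emitwE; apply: (closed_out b qL (kwq q0 q0L)).2.
apply: (mulfI dn0); rewrite -natrM E natr_sum mulr_sumr.
rewrite [RHS](reindex _ (onW_bij _ (enum_val_bij letter))) /=.
apply: eq_bigr => l _; rewrite !mxE natrM mulrA (mulrC d%:R) divfK // mulrC.
by rewrite -/b.
Qed.

Lemma production_matrixP : is_production_matrix (production_matrix N).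
Proof. by have [P HP] := production_matrix_exists; apply: xgetPex; exists P. Qed.

Definition prod_coef b a : rat := production_matrix N (enum_rank b) (enum_rank a).

Lemma prod_coef_out q w b : q \in Loc N -> act w q = q ->
  (out w q b)%:R = \sum_a prod_coef b a * (cnt w a)%:R :> rat.
Proof.
move=> qL wq; pose k : {ffun letter -> nat} := [ffun a => cnt w a].
have Kk : total_kernel N (intvec k).
  have := (kernelP w [::] qL).2 wq; congr (total_kernel N).
  by apply/ffunP => a; rewrite !ffunE subr0.
have := congr1 (fun v : 'cV_ _ => v (enum_rank b) 0) (production_matrixP Kk qL).
rewrite /= !mxE enum_rankK /emitn emitwE.
have -> : out (word k) q b = out w q b.
  by apply: (out_count stepC emitC) => a; rewrite cnt_word ffunE.
move=> <-; rewrite [RHS](reindex _ (onW_bij _ (enum_val_bij letter))) /=.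
by apply: eq_bigr => l _; rewrite !mxE ffunE /prod_coef enum_valK.
Qed.

Hypothesis N_agent : agent_network N.
Hypothesis N_conn : strongly_connected N.

Lemma prod_coef_period q a b : q \in Loc N ->
  (out (nseq d a) q b)%:R = prod_coef b a * d%:R :> rat.
Proof.
move=> qL; rewrite (prod_coef_out _ qL) => [|]; last by rewrite act_nseq Loc_periodic.
rewrite (bigD1 a) //= cnt_nseq eqxx mul1n big1 ?addr0 // => c /negPf ca.
by rewrite cnt_nseq eq_sym ca mulr0.
Qed.

Lemma prod_coef_ge0 b a : 0 <= prod_coef b a.
Proof.
have [q qL] := Loc_nonempty.
have d_rat : 0 < d%:R :> rat by rewrite ltr0n.
by rewrite -(pmulr_lge0 _ d_rat) -(prod_coef_period _ _ qL) ler0n.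
Qed.

Lemma prod_coef_sum a : \sum_b prod_coef b a = 1.
Proof.
have [q qL] := Loc_nonempty.
have dn0 : d%:R != 0 :> rat by rewrite pnatr_eq0 -lt0n.
apply: (mulIf dn0); rewrite mulr_suml mul1r.
under eq_bigr do rewrite -(prod_coef_period _ _ qL).
rewrite -natr_sum (sum_out (@step _ _ N) N_agent) (bigD1 a) //= big1 => [|c /negPf ca].
  by rewrite cnt_nseq eqxx mul1n addn0.
by rewrite cnt_nseq eq_sym ca.
Qed.

Lemma prod_coef_conn a b : connect (fun a b => 0 < prod_coef b a) a b.
Proof. exact: N_conn. Qed.

(** * Restriction to locally recurrent states *)

Definition locstate : finType := {q : gstate | q \in Loc N}.

Lemma step_Loc a q : q \in Loc N -> step a q \in Loc N.
Proof. exact: (@act_Loc [:: a]). Qed.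

Definition lstep a (x : locstate) : locstate :=
  exist _ (step a (val x)) (step_Loc a (valP x)).
Definition lemit a (x : locstate) : letter -> nat := fun b => emit a (val x) b.

Local Notation lact := (actw lstep).
Local Notation lout := (outw lstep lemit).

Lemma val_lact w x : val (lact w x) = act w (val x).
Proof. by elim: w x => //= a w IH x; rewrite IH. Qed.

Lemma loutE w x b : lout w x b = out w (val x) b.
Proof. by elim: w x => //= a w IH x; rewrite IH. Qed.

Lemma lact_eq w w' x : lact w x = lact w' x <-> act w (val x) = act w' (val x).
Proof.
by rewrite -!val_lact; split=> [->|/val_inj].
Qed.

Lemma legal_afterE n x m w :
  legal_after lstep lemit n x m w =
    legal_after (@step _ _ N) (fun a q => emit a q) n (val x) m w.
Proof. by elim: w m => //= a w IH m; rewrite IH loutE. Qed.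

(** * Legal executions and recurrence *)

Lemma fireE w c : firew w c =
  ([ffun b => c.1 b + (out w c.2 b)%:Z - (cnt w b)%:Z], act w c.2).
Proof.
elim: w c => [|a w IH] [x q] /=.
  by congr (_, _); apply/ffunP => b; rewrite ffunE addrK.
rewrite IH /=; congr (_, _); apply/ffunP => b.
rewrite [LHS]ffunE [RHS]ffunE [X in X + _ - _ = _]ffunE cnt_cons [b == a]eq_sym.
by rewrite /=; lia.
Qed.

Lemma firew_cat w w' c : firew (w ++ w') c = firew w' (firew w c).
Proof. by elim: w c => //= a w IH c. Qed.

Lemma legal_cat w w' c : legal (w ++ w') c = legal w c && legal w' (firew w c).
Proof. by elim: w c => //= a w IH c; rewrite IH andbA. Qed.

Lemma legal_fire (n : {ffun letter -> nat}) q m w :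
  legal w (firew m (intvec n, q)) =
    legal_after (@step _ _ N) (fun a q => emit a q) n q m w.
Proof.
elim: w m => //= a w IH m.
have -> : fire a (firew m (intvec n, q)) = firew (rcons m a) (intvec n, q).
  by rewrite -cats1 firew_cat.
by rewrite IH; congr (_ && _); rewrite fireE /= !ffunE /=; lia.
Qed.

(** Returning after a nonempty execution gives a legal cycle; its counts are fixed by P, hence
    positive, and a cycle through all letters makes [q] locally recurrent. *)
Lemma recurrent_full_cycle (n : {ffun letter -> nat}) q : recurrent (intvec n, q) ->
  exists2 x, val x = q & exists w, full_cycle lstep lemit n x w.
Proof.
case=> -[w0 w0n lw0] rec; pose c : config N := (intvec n, q).
have [|w1 lw1 w1c] := rec (firew w0 c).
  by exists (firew w0 c); split; [exists [::]|exists w0].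
pose w := w0 ++ w1.
have lw : legal w c by rewrite legal_cat lw0.
have wc : firew w c = c by rewrite firew_cat.
have wq : act w q = q by have := congr1 snd wc; rewrite fireE.
have wE b : cnt w b = out w q b.
  have := congr1 (fun c : config N => c.1 b) wc; rewrite fireE /= ffunE; lia.
have w_gt0 a : (0 < cnt w a)%N.
  (* [q] is not yet known to be locally recurrent, so the cycle is transported to a state that
     is. *)
  have [q' q'L] := Loc_nonempty.
  have [wq' _] := closed_out a q'L wq.
  have [a0 a0w] : exists a0, (0 < cnt w a0)%N.
    case: (w0) w0n @w {lw0 lw wc wq wE wq'} => // a0 w0' _; exists a0.
    by rewrite /= cnt_cons eqxx.
  rewrite -(ltr0n rat).
  apply: (perron_pos prod_coef_ge0 prod_coef_conn (k := fun a => (cnt w a)%:R) (a0 := a0)).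
  - by move=> b; rewrite ler0n.
  - by rewrite pnatr_eq0 -lt0n.
  - move=> b; rewrite -(prod_coef_out _ q'L wq') wE; congr _%:R.
    exact: (closed_out b q'L wq).2.
have qL : q \in Loc N.
  apply: Loc_of_periodic => a.
  (* [d] copies of [w] without [d] letters [a], which are fired last; so [q] is in the image of the
     idempotent [iter d (step a)]. *)
  pose v := word (fun b => d * cnt w b - (a == b) * d)%N.
  have -> : q = act (nseq d a) (act v q).
    rewrite -act_cat -[LHS](act_flatten_nseq d wq); apply: (act_count stepC) => b.
    rewrite cnt_flatten_nseq cnt_cat cnt_word cnt_nseq subnK //.
    by case: (a == b); rewrite ?mul0n // mul1n leq_pmulr.
  by rewrite act_nseq -iterD iter_fact.
exists (exist _ q qL) => //; exists w; split=> //.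
- by rewrite legal_afterE -legal_fire.
- by apply/(lact_eq w [::]).
- by move=> b; rewrite loutE wE.
Qed.

(** Enough repetitions of the cycle dominate the word [u] leading to [c3]; the exchange lemma
    completes [u] to them legally, which leads back from [c3]. *)
Lemma full_cycle_recurrent (n : {ffun letter -> nat}) x w (a0 : letter) :
  full_cycle lstep lemit n x w -> recurrent (intvec n, val x).
Proof.
set q := val x; pose c : config N := (intvec n, q).
case; rewrite legal_afterE => lw /(lact_eq w [::]) wq wE w_gt0.
have {}wE b : cnt w b = out w q b by rewrite wE loutE.
split.
  exists w; last by rewrite -[(_, _)]/(firew [::] c) legal_fire.
  by apply: contraTneq (w_gt0 a0) => ->.
move=> c' [c3 [[v lv vc'] [u lu uc]]].
pose r := (\sum_b cnt u b)%N; pose wr := flatten (nseq r w).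
have lwr : legal_after (@step _ _ N) (fun a q => emit a q) n q [::] wr.
  rewrite /wr; elim: (r) => //= k IH.
  apply: (legal_after_trans (x := n)); rewrite ?wq //.
  by move=> b; rewrite wE.
have u0 b : (cnt [::] b <= cnt u b)%N by [].
have [u' lu' u'E] := exchange stepC emitC u0 lwr.
have uu' b : cnt (u ++ u') b = cnt wr b.
  rewrite u'E /=; apply/maxn_idPl; rewrite cnt_flatten_nseq.
  rewrite (leq_trans _ (leq_pmulr r (w_gt0 b))) //.
  by rewrite /r (bigD1 b) //= leq_addr.
exists (v ++ u'); first by rewrite legal_cat lv vc' -uc legal_fire.
rewrite firew_cat vc' -uc -firew_cat fireE /=; congr (_, _).
  apply/ffunP => b; rewrite !ffunE (out_count stepC emitC _ _ uu') uu'.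
  by rewrite out_flatten_nseq // cnt_flatten_nseq wE addrK.
by rewrite (act_count stepC _ uu') act_flatten_nseq.
Qed.

Lemma Rec_index (n : {ffun letter -> nat}) (a0 : letter) :
  (subgroup_index (total_kernel N))%:R *
    \det (drift_mx prod_coef (fun a => 0 < n a)%N) = #|Rec N n|%:R.
Proof.
have [s0 ns0|n0] := pickP (fun a => 0 < n a)%N; last first.
  rewrite (det_drift_eq0 prod_coef_sum a0) ?mulr0 => [|a]; last by rewrite n0.
  rewrite (_ : Rec N n = finset.set0) ?cards0 //; apply/setP => q; rewrite !inE.
  apply/negP => /asboolP[[[//|a w] _ /=]]; rewrite ffunE /=.
  by have := n0 a; case: (n a).
have [q0 q0L] := Loc_nonempty.
have lK x w w' : total_kernel N [ffun a => (cnt w a)%:Z - (cnt w' a)%:Z] <->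
    lact w x = lact w' x.
  by rewrite lact_eq; apply/kernelP/(valP x).
have lconn (x y : locstate) : exists w, lact w x = y.
  have [w wE] := Loc_conn (val x) (valP y); exists w.
  by apply: val_inj; rewrite val_lact.
have lC a b x : lstep a (lstep b x) = lstep b (lstep a x).
  by apply: val_inj; rewrite /= stepC.
have lMC a b x c : (lemit a x c + lemit b (lstep a x) c =
    lemit b x c + lemit a (lstep b x) c)%N by apply: emitC.
have lout_prod x w b : lact w x = x ->
    (lout w x b)%:R = \sum_a prod_coef b a * (cnt w a)%:R :> rat.
  move=> /(lact_eq w [::]) wx; rewrite loutE; exact: prod_coef_out (valP x) wx.
rewrite (card_full_cycle lC lMC _ lconn lK prod_coef_ge0 prod_coef_sum prod_coef_conn
  lout_prod (exist _ q0 q0L) ns0); last by move=> a x; apply: N_agent.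
congr _%:R; rewrite -(card_imset _ val_inj); apply: eq_card => q.
apply/imsetP/idP => [[x + ->]|]; rewrite inE.
  by move=> /asboolP[w /(full_cycle_recurrent a0) rec]; rewrite inE; apply/asboolP.
move=> /asboolP/recurrent_full_cycle[x xq xw]; exists x => //.
by rewrite inE; apply/asboolP.
Qed.

End Bridge.

Theorem theorem7p10 (V : finType) (edge : V -> V -> finType)
    (N : network edge) (V_gt0 : (0 < #|V|)%N)
    (N_irr : locally_irreducible N)
    (N_conn : strongly_connected N)
    (N_agent : agent_network N) :
  (subgroup_index (total_kernel N))%:R *
    \det (diag_mx (\row_(i < #|letter N|) (1 - 'z_(enum_val i))^-1)
          - map_mx (fps_const (letter N) (R := rat)) (production_matrix N))
  = Fps (fun n : {ffun letter N -> nat} => #|Rec N n|%:R).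
Proof.
have /card_gt0P/sigW[v _] := V_gt0.
have /card_gt0P/sigW[a0 _] := alphabet_gt0 N v.
apply: fpsP => n; rewrite mulr_natl fpscoefMn fpscoef_det_geometric -mulr_natl.
exact: (Rec_index N_irr N_agent N_conn n (Tagged (alphabet N) a0 : letter N)).
Qed.
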